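(* Suppose that the sequence of stochastic block models and seed numbers satisfies assumptions $(C)$ and that condition $(\mathbf{Sub})$ holds, that is, $\overset{\circ}{\mathcal{E}}_1\cap\overset{\circ}{\mathcal{E}}_2\neq\emptyset$ (all notation as in the context). Then for every $\varepsilon>0$ there exists a constant $c(\varepsilon)\in(0,\infty)$ such that, as $n\to\infty$, $$P\left(\left|\frac{|\mathcal{G}|}{g_1}-x_*\right|>\varepsilon\right)=O\left(\mathrm{e}^{-c(\varepsilon)g_1}\right),$$ where $\mathcal{G}$ is the final set of active nodes and $$x_*:=z_1^*+z_2^*\,(\nu\mu^r)^{1/(r-1)}>0,$$ with $(z_1^*,z_2^* )$ the point of $\widetilde{\mathcal{E}}_1\cap\widetilde{\mathcal{E}}_2$ having the smallest first coordinate.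
   Context: Model. For each $n=n_1+n_2$ (with $n_1,n_2$ depending on $n$), the stochastic block model $G=G(n_1,n_2,p_1,p_2,q)$, with $p_1,p_2,q\in[0,1)$ depending on $n$, is the random graph formed by the union of two disjoint Erdős–Rényi random graphs $G_i=G(n_i,p_i)$, $i=1,2$ (the communities; $n_i$ nodes, each pair of nodes independently joined with probability $p_i$), where in addition each pair of nodes in different communities is joined by an edge independently with probability $q$. Bootstrap percolation. Fix an integer $r\ge 2$. Initially, for $i=1,2$, a number $a_i\le n_i$ (depending on $n$) of nodes, called seeds, are chosen uniformly at random among the nodes of $G_i$; seeds are active and all other nodes are inactive. An inactive node becomes active as soon as at least $r$ of its neighbors are active, and then remains active forever. The process stops when no more nodes can be activated. $\mathcal{G}$ denotes the final set of active nodes (of the whole graph, seeds included), and $|\cdot|$ denotes cardinality. Asymptotics. All limits are as $n\to\infty$; $f_1\ll f_2$ means $f_1/f_2\to0$, $f_1\sim f_2$ means $f_1/f_2\to1$, and $f_1=O(f_2)$ means $\limsup|f_1/f_2|<\infty$. Define $$g_i:=\left(1-\frac1r\right)\left(\frac{(r-1)!}{n_ip_i^r}\right)^{\frac1{r-1}},\quad i=1,2.$$ Assumptions $(C)$: - $n_1\sim\nu n_2$ for some $\nu\in(0,\infty)$; - $q\sim\gamma p_1$ for some $\gamma\in(0,\infty)$ and $p_1\sim\mu p_2$ for some $\mu\in(0,\infty)$; - $1/n_i\ll p_i\ll 1/n_i^{1/r}$ for $i=1,2$; - $a_i/g_i\to\alpha_i\ge0$ for $i=1,2$; - $\alpha_1\ge\alpha_2$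 and $\alpha_1>0$. Notation. $\chi_{12}:=\gamma(\nu\mu^r)^{1/(r-1)}$, $\chi_{21}:=\gamma(\nu\mu)^{-1/(r-1)}$. For $\mathbf{x}=(x_1,x_2)\in[0,\infty)^2$ and $\{i,j\}=\{1,2\}$, $$\rho_i(\mathbf{x}):=\alpha_i-x_i+r^{-1}(1-r^{-1})^{r-1}(x_i+\chi_{ij}x_j)^r.$$ $$\mathcal{D}:=\left\{\mathbf{x}\in[0,r/(r-1)]^2:\ x_1+\chi_{12}x_2\le\tfrac r{r-1},\ x_2+\chi_{21}x_1\le\tfrac r{r-1}\right\},$$ $\mathcal{E}_i:=\{\mathbf{x}\in\mathcal{D}:\rho_i(\mathbf{x})\le0\}$ and $\widetilde{\mathcal{E}}_i:=\{\mathbf{x}\in\mathcal{D}:\rho_i(\mathbf{x})=0\}$ for $i=1,2$. For $\mathcal{H}\subset\mathcal{D}$, $\overset{\circ}{\mathcal{H}}$ denotes its interior with respect to the Euclidean topology of $\mathbb{R}^2$ restricted to $\mathcal{D}$ (i.e. the interior relative to $\mathcal{D}$). *)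

(* Defs.v *)
From HB Require Import structures.
From mathcomp Require Import all_boot all_order all_algebra.
From mathcomp Require Import all_classical all_reals all_analysis.
Set Implicit Arguments.
Unset Strict Implicit.
Unset Printing Implicit Defensive.
Import Order.TTheory GRing.Theory Num.Theory.
Import numFieldNormedType.Exports.
Local Open Scope classical_set_scope.
Local Open Scope ring_scope.

(* A graph on the finite vertex type V is given by its set of edges, each edge
   being a 2-element set of vertices. *)

Section Bootstrap.
Variables (V : finType) (r : nat) (g : {set {set V}}).

Definition neighbors (v : V) : {set V} :=
  finset (fun u => (u != v) && ([set u; v]%SET \in g)).

Definition activate (A : {set V}) : {set V} :=
  A :|: finset (fun v => r <= #|neighbors v :&: A|)%N.

(* #|V| synchronous rounds suffice for the process to stop: see activate_final. *)
Definition final_active (S : {set V}) : {set V} := iter #|V| activate S.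

Lemma activate_final (S : {set V}) :
  activate (final_active S) = final_active S.
Proof.
pose I k := iter k activate S.
suff [k kV fk] : exists2 k, (k <= #|V|)%N & activate (I k) = I k.
  by rewrite /final_active -(subnK kV) iterD -/(I k) iter_fix.
case: (boolP [exists k : 'I_#|V|.+1, activate (I k) == I k]).
  by move=> /existsP[k /eqP fk]; exists k => //; rewrite -ltnS.
move=> /existsPn nf.
suff big k : (k <= #|V|.+1)%N -> (k <= #|I k|)%N.
  by have := big _ (leqnn _); rewrite leqNgt ltnS max_card.
elim: k => // k IHk kV; apply: leq_ltn_trans (IHk (ltnW kV)) _.
apply: proper_card; rewrite finset.properEneq finset.subsetUl andbT eq_sym.
exact: (nf (Ordinal kV)).
Qed.

End Bootstrap.

Section Model.
Variables (R : realType) (n1 n2 : nat).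
Local Notation V := ('I_n1 + 'I_n2)%type.

Definition community1 : {set V} := finset (fun v => if v is inl _ then true else false).
Definition community2 : {set V} := finset (fun v => if v is inr _ then true else false).

(* Probability that e is an edge; it vanishes unless e is a pair of nodes. *)
Definition edge_prob (p1 p2 q : R) (e : {set V}) : R :=
  if #|e| != 2%N then 0
  else if e \subset community1 then p1
  else if e \subset community2 then p2
  else q.

Definition sbm_mass (p1 p2 q : R) (g : {set {set V}}) : R :=
  \prod_(e : {set V})
     (if e \in g then edge_prob p1 p2 q e else 1 - edge_prob p1 p2 q e).

Definition seed_mass (C : {set V}) (a : nat) (S : {set V}) : R :=
  if (S \subset C) && (#|S| == a) then ('C(#|C|, a)%:R)^-1 else 0.

(* Probability of the event E, a predicate of the graph and of the set of all
   seeds; the graph and the seed sets of both communities are independent. *)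
Definition sbm_prob (p1 p2 q : R) (a1 a2 : nat)
    (E : {set {set V}} -> {set V} -> bool) : R :=
  \sum_(g : {set {set V}}) \sum_(S1 : {set V})
    \sum_(S2 : {set V} | E g (S1 :|: S2)%SET)
      sbm_mass p1 p2 q g * seed_mass community1 a1 S1 * seed_mass community2 a2 S2.

Lemma sum_sbm_mass (p1 p2 q : R) : \sum_g sbm_mass p1 p2 q g = 1.
Proof.
rewrite /sbm_mass -(bigA_distr _ _ (edge_prob p1 p2 q) (fun e => 1 - edge_prob p1 p2 q e)).
by apply: big1 => e _; rewrite /= addrCA subrr addr0.
Qed.

Lemma sum_seed_mass (C : {set V}) (a : nat) :
  (a <= #|C|)%N -> \sum_S seed_mass C a S = 1.
Proof.
move=> aC; rewrite -big_mkcond/= sumr_const.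
rewrite -[X in _ *+ X]cardsE cards_draws -[LHS]mulr_natl divff//.
by rewrite pnatr_eq0 -lt0n bin_gt0.
Qed.

End Model.

Section Asymptotics.
Variable R : realType.
Implicit Types f : nat -> R.

(* As x / 0 = 0 in this library, f2 is required to be eventually nonzero. *)
Definition much_smaller f1 f2 : Prop :=
  (\forall n \near \oo, f2 n != 0) /\ f1 n / f2 n @[n --> \oo] --> (0 : R).

Definition equivalent f1 f2 : Prop := f1 n / f2 n @[n --> \oo] --> (1 : R).

Definition big_O f1 f2 : Prop :=
  (limn_esup (fun n => (`|f1 n / f2 n|)%:E) < +oo)%E.

End Asymptotics.

Section LimitRegions.
Variables (R : realType) (r : nat) (nu gamma mu : R).

(* The critical number g_i of seeds, for n nodes and edge probability p. *)
Definition crit_seeds (n : nat) (p : R) : R :=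
  (1 - r%:R^-1) * ((r.-1)`!%:R / (n%:R * p ^+ r)) `^ (r.-1%:R^-1).

Definition chi12 : R :=
  gamma * (nu * mu ^+ r) `^ (r.-1%:R^-1).

Definition chi21 : R :=
  gamma * (nu * mu) `^ (- r.-1%:R^-1).

(* rho_i at the point whose own coordinate is x and other coordinate is y. *)
Definition rho (alpha chi x y : R) : R :=
  alpha - x + r%:R^-1 * (1 - r%:R^-1) ^+ r.-1 * (x + chi * y) ^+ r.

Definition domD : set (R * R) :=
  [set x | [/\ 0 <= x.1 <= r%:R / r.-1%:R, 0 <= x.2 <= r%:R / r.-1%:R,
               x.1 + chi12 * x.2 <= r%:R / r.-1%:R
             & x.2 + chi21 * x.1 <= r%:R / r.-1%:R]].

Definition E1 (alpha1 : R) : set (R * R) :=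
  [set x | domD x /\ rho alpha1 chi12 x.1 x.2 <= 0].
Definition E2 (alpha2 : R) : set (R * R) :=
  [set x | domD x /\ rho alpha2 chi21 x.2 x.1 <= 0].
Definition E1_tilde (alpha1 : R) : set (R * R) :=
  [set x | domD x /\ rho alpha1 chi12 x.1 x.2 = 0].
Definition E2_tilde (alpha2 : R) : set (R * R) :=
  [set x | domD x /\ rho alpha2 chi21 x.2 x.1 = 0].

(* Interior relative to domD of a subset H of domD: the points outside domD,
   which are isolated in the type subspace domD, do not belong to H. *)
Definition relative_interior (H : set (R * R)) : set (R * R) :=
  @interior (subspace domD) H.

Lemma relative_interiorP (H : set (R * R)) (x : R * R) : H `<=` domD ->
  relative_interior H x <->
  domD x /\ exists U : set (R * R), [/\ open U, U x & U `&` domD `<=` H].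
Proof.
move=> HD; rewrite /relative_interior /interior/=; split.
  move=> Hx; have Dx : domD x by apply: HD; exact: (@nbhs_singleton (subspace domD)).
  split => //; move: Hx.
  change (@nbhs_subspace _ domD x H -> exists U : set (R * R), [/\ open U, U x & U `&` domD `<=` H]).
  rewrite -(nbhs_subspace_in Dx) nbhsE => -[U [oU Ux] UH].
  by exists U; split => // y [Uy Dy]; exact: UH.
move=> [Dx [U [oU Ux UH]]].
change (@nbhs_subspace _ domD x H); rewrite -(nbhs_subspace_in Dx) nbhsE.
by exists U => // y Uy Dy; exact: UH.
Qed.

(* Strictness makes the point with smallest first coordinate unique. *)
Definition has_smallest_first (A : set (R * R)) (z : R * R) : Prop :=
  A z /\ forall w, A w -> w <> z -> z.1 < w.1.

End LimitRegions.

(* Main.v *)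
(* Explore the active nodes one at a time and record, for each node v, its number
   of explored neighbours. If every further exploration marks v independently, v
   ends up active with a probability that depends only on its current marks and on
   the number of explorations left in each community; so, for a real beta, the
   product over the non-seeds of one community of the conditional expectation of
   beta^[v has at least r marks at the end] is a martingale. Comparing its initial
   and final values gives Chernoff bounds, valid for each fixed set of seeds:
   - for the event that the exploration reaches k_i nodes in community i, when the
     expected number of active nodes after (k_1, k_2) explorations is below k_i;
   - for the event that the process stops at exactly (t_1, t_2) nodes, when after
     (t_1, t_2) explorations it should have activated more than t_i nodes.
   After rescaling by g_1 and g_2 these drifts are rho_1 and rho_2. Under (Sub) the
   map F_i(x) = rho_i(x) + x_i, which is increasing and convex, has a least fixed
   point z and a point y > z with F(y) < y. By convexity F(u) < u on the segment
   from z (excluded) to y, which bounds the process from above arbitrarily close to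
   z, and any x that is not close to z from above has some rho_i(x) > 0, which,
   summed over the polynomially many (t_1, t_2), bounds it from below. *)
Require Import Defs.
From mathcomp Require Import all_boot all_order all_algebra.
From mathcomp Require Import ring lra reals.
Set Implicit Arguments.
Unset Strict Implicit.
Unset Printing Implicit Defensive.
Import Order.TTheory GRing.Theory Num.Theory.
Local Open Scope ring_scope.

(** * Exploration of a random graph *)

Section RandomSet.
Variables (R : realFieldType) (T : finType) (w : T -> R).
Implicit Types (g : {set T}) (e : T).

Definition bernoulli_mass g : R := \prod_e (if e \in g then w e else 1 - w e).

(** The deterministic form of independence from the coordinate [e]: the value of [X] is the same
    whether or not [e] is drawn. *)
Definition ignores e (A : Type) (X : {set T} -> A) :=
  forall g, X (e |: g) = X (g :\ e).

Lemma ignores_in e A (X : {set T} -> A) g : ignores e X -> X (e |: g) = X g.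
Proof.
move=> iX; case: (boolP (e \in g)) => eg.
  by rewrite (finset.setUidPr _)// finset.sub1set.
rewrite iX (_ : g :\ e = g)//; apply/eqP.
by rewrite finset.eqEsubset finset.subsetDl finset.subsetD1 eg subxx.
Qed.

Lemma ignores_out e A (X : {set T} -> A) g : ignores e X -> X (g :\ e) = X g.
Proof. by move=> iX; rewrite -iX ignores_in. Qed.

Lemma bernoulli_sum_split e (Y : {set T} -> R) :
  \sum_g bernoulli_mass g * Y g =
  \sum_(g : {set T} | e \notin g)
    (\prod_(i | i != e) (if i \in g then w i else 1 - w i)) *
      (w e * Y (e |: g) + (1 - w e) * Y g).
Proof.
rewrite (bigID (fun g : {set T} => e \in g))/=.
rewrite (reindex_onto (fun g : {set T} => e |: g) (fun g => g :\ e))/=; last first.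
  by move=> g eg; rewrite finset.setD1K.
rewrite (eq_bigl (fun g : {set T} => e \notin g)) => [|g]; last first.
  rewrite finset.setU11 /=; apply/eqP/idP => [<-|eg]; first by rewrite finset.setD11.
  by rewrite finset.setU1K.
rewrite -big_split/=; apply: eq_bigr => g eg.
have E : \prod_(i | i != e) (if i \in e |: g then w i else 1 - w i) =
         \prod_(i | i != e) (if i \in g then w i else 1 - w i).
  by apply: eq_bigr => i ie; rewrite !inE (negPf ie).
rewrite /bernoulli_mass !(bigD1 e (P := predT))//= (negPf eg) finset.setU11 E.
by ring.
Qed.

Lemma bernoulli_resample e (Y : {set T} -> R) :
  \sum_g bernoulli_mass g * Y g =
  \sum_g bernoulli_mass g * (w e * Y (e |: g) + (1 - w e) * Y (g :\ e)).
Proof.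
rewrite !(bernoulli_sum_split e); apply: eq_bigr => g eg; congr (_ * _).
rewrite finset.setUA finset.setUid finset.setU1K//.
rewrite (_ : g :\ e = g) -?mulrDl 1?[w e + _]addrC ?subrK ?mul1r//.
apply/eqP; rewrite finset.eqEsubset finset.subsetDl finset.subsetD1 eg.
by rewrite subxx.
Qed.

(** The coordinates [ed i] are averaged out one at a time. When one is resampled, [xi] and the other
    factors ignore it, and its averaged factor joins the weight, which still ignores the remaining
    coordinates. *)
Lemma bernoulli_indep (I : eqType) (s : seq I) (ed : I -> T)
    (F : I -> {set T} -> bool -> R) (xi : {set T} -> R) :
  uniq s -> {in s &, injective ed} ->
  (forall i, i \in s -> ignores (ed i) xi) ->
  (forall i j b, i \in s -> j \in s -> ignores (ed i) (fun g => F j g b)) ->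
  \sum_g bernoulli_mass g * (xi g * \prod_(i <- s) F i g (ed i \in g)) =
  \sum_g bernoulli_mass g *
    (xi g * \prod_(i <- s) (w (ed i) * F i g true + (1 - w (ed i)) * F i g false)).
Proof.
elim: s xi => [|i s IH] xi /=; first by under eq_bigr do rewrite big_nil;
  under [RHS]eq_bigr do rewrite big_nil.
move=> /andP[si us] inj ixi iF.
have mi : i \in i :: s by rewrite mem_head.
have ms j : j \in s -> j \in i :: s by rewrite inE orbC => ->.
rewrite (bernoulli_resample (ed i)).
pose xi' g := xi g * (w (ed i) * F i g true + (1 - w (ed i)) * F i g false).
transitivity (\sum_g bernoulli_mass g * (xi' g * \prod_(i <- s) F i g (ed i \in g))).
  apply: eq_bigr => g _; congr (_ * _); rewrite !big_cons !finset.setU11 finset.setD11.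
  have E b : \prod_(j <- s) F j (if b then ed i |: g else g :\ ed i)
               (ed j \in (if b then ed i |: g else g :\ ed i)) =
             \prod_(j <- s) F j g (ed j \in g).
    rewrite !big_seq; apply: eq_bigr => j js.
    have jd : ed j != ed i.
      apply: contra si => /eqP/inj <-//; exact: ms.
    case: b; rewrite !inE (negPf jd) /=.
      by rewrite (ignores_in _ (iF i j _ mi (ms _ js))).
    by rewrite (ignores_out _ (iF i j _ mi (ms _ js))).
  rewrite (E true) (E false) /xi'.
  rewrite (ignores_in _ (ixi i mi)) (ignores_out _ (ixi i mi)).
  rewrite (ignores_in _ (iF i i true mi mi)) (ignores_out _ (iF i i false mi mi)).
  by ring.
rewrite IH//.
- by apply: eq_bigr => g _; rewrite /xi' big_cons; ring.
- by move=> j k js ks; apply: inj; exact: ms.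
- move=> j js g; rewrite /xi' (ixi j (ms _ js)).
  by rewrite (iF j i true (ms _ js) mi) (iF j i false (ms _ js) mi).
- by move=> j k b js ks; apply: iF; exact: ms.
Qed.

End RandomSet.

(** * The exploration process with budgets *)

Section Exploration.
Variables (V : finType) (r : nat) (col : V -> bool) (k : bool -> nat) (S : {set V}).
Implicit Types (g : {set {set V}}) (A B : {set V}) (u v : V) (e : {set V}).

Definition community b : {set V} := finset (fun v => col v == b).

Definition marks A g v := #|neighbors g v :&: A|.

Definition activated A g : {set V} := S :|: finset (fun v => r <= marks A g v)%N.

Definition next A g : option V := [pick v in activated A g :\: A].

(* Explores one active node at a time, and stops for good when the budget k of
   the community of the next node is exhausted. *)
Fixpoint explore j A g : {set V} :=
  if j is j'.+1 then
    if next A g is Some u then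
      if (#|A :&: community (col u)| < k (col u))%N then explore j' (u |: A) g else A
    else A
  else A.

Lemma marks_mono A B g v : A \subset B -> (marks A g v <= marks B g v)%N.
Proof. by move=> AB; rewrite subset_leq_card// finset.setIS. Qed.

Lemma activated_mono A B g : A \subset B -> activated A g \subset activated B g.
Proof.
move=> AB; apply: finset.setUS; apply/fintype.subsetP => v; rewrite !inE => /leq_trans.
by apply; exact: marks_mono.
Qed.

Variant next_spec A g : option V -> Prop :=
| NextSome u of u \in activated A g & u \notin A : next_spec A g (Some u)
| NextNone of activated A g \subset A : next_spec A g None.

Lemma nextP A g : next_spec A g (next A g).
Proof.
rewrite /next; case: pickP => [u|N].
  by rewrite inE => /andP[uA uact]; constructor.
constructor; rewrite -finset.setD_eq0; apply/eqP/setP => v.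
by rewrite N inE.
Qed.

Lemma explore_activated j A g :
  A \subset activated A g -> explore j A g \subset activated (explore j A g) g.
Proof.
elim: j A => //= j IH A AA; case: nextP => // u ua _; case: ifP => // _; apply: IH.
apply/fintype.subsetP => v; rewrite finset.in_setU1 => /orP[/eqP->|vA].
  by apply: (fintype.subsetP (activated_mono g _)) ua; exact: finset.subsetUr.
apply: (fintype.subsetP (activated_mono g _)); first exact: finset.subsetUr.
exact: (fintype.subsetP AA).
Qed.

Lemma card_community_setU1 u A b : u \notin A ->
  #|(u |: A) :&: community b| = ((col u == b) + #|A :&: community b|)%N.
Proof.
move=> uA; rewrite finset.setIUl; case: (boolP (col u == b)) => cu.
  rewrite (_ : [set u] :&: _ = [set u]); last by
    apply/finset.setIidPl; rewrite finset.sub1set inE.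
  by rewrite finset.cardsU1 inE (negPf uA).
rewrite (_ : [set u] :&: _ = finset.set0) ?finset.set0U//.
by apply/setP => v; rewrite !inE; apply/andP => -[/eqP->]; apply/negP.
Qed.

Lemma explore_budget j A g :
  (forall b, (#|A :&: community b| <= k b)%N) ->
  forall b, (#|explore j A g :&: community b| <= k b)%N.
Proof.
elim: j A => //= j IH A kA; case: nextP => // u _ uA; case: ifP => // ku; apply: IH => b.
rewrite card_community_setU1//; case: eqP => [<-|_]; first by rewrite add1n.
exact: kA.
Qed.

Lemma sub_final g : S \subset final_active r g S.
Proof.
rewrite /final_active; elim: #|V| => //= m /fintype.subset_trans; apply.
exact: finset.subsetUl.
Qed.

Lemma activated_final A g : A \subset final_active r g S ->
  activated A g \subset final_active r g S.
Proof.
move=> AF; apply/fintype.subsetP => u ua; rewrite -activate_final.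
move: ua; rewrite !inE => /orP[/(fintype.subsetP (sub_final g))->//|ru]; apply/orP; right.
exact: leq_trans ru (marks_mono _ _ AF).
Qed.

Lemma explore_final j A g : A \subset final_active r g S ->
  explore j A g \subset final_active r g S.
Proof.
elim: j A => //= j IH A AF; case: nextP => // u ua _; case: ifP => // _; apply: IH.
rewrite finset.subUset AF andbT finset.sub1set.
exact: (fintype.subsetP (activated_final AF)).
Qed.

(** Each exploration removes a node from the complement, so the fuel cannot run out first: either
    every active node has been explored, or the budget of the next node is exhausted. *)
Lemma explore_stop j A g : (#|~: A| <= j)%N ->
  let B := explore j A g in
  activated B g \subset B \/
  exists u, [/\ u \in activated B g, u \notin B &
    (k (col u) <= #|B :&: community (col u)|)%N].
Proof.
elim: j A => [|j IH] A /=.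
  rewrite leqn0 cards_eq0 -finset.setCT (inj_eq (@finset.setC_inj _)) => /eqP ->.
  by left.
move=> cA; case: nextP => [u ua uA|]; last by left.
case: ifPn => [_|]; last by rewrite -leqNgt => ku; right; exists u.
apply: IH; rewrite finset.setCU finset.setIC -finset.setDE.
by move: cA; rewrite (cardsD1 u) inE uA.
Qed.

Lemma final_sub A g : activated A g \subset A -> final_active r g S \subset A.
Proof.
move=> AA; rewrite /final_active.
have SA : S \subset A by apply: fintype.subset_trans AA; exact: finset.subsetUl.
elim: #|V| => //= m IH; rewrite /activate finset.subUset IH/=.
apply: fintype.subset_trans AA; apply/fintype.subsetP => v; rewrite !inE => H.
by rewrite (leq_trans H) ?orbT//; exact: marks_mono.
Qed.

Definition explored g := explore #|V| finset.set0 g.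

(** An exploration that closes up contains the final set, hence fills the budget of the given
    community; otherwise it was stopped by a full budget, possibly that of the other community. *)
Lemma explored_reach g :
  (exists b, (k b <= #|final_active r g S :&: community b|)%N) ->
  exists b, #|explored g :&: community b| = k b.
Proof.
move=> [c kc].
have bud := @explore_budget #|V| finset.set0 g.
have {}bud b' : (#|explored g :&: community b'| <= k b')%N.
  by apply: bud => b''; rewrite finset.set0I finset.cards0.
have [|B|[u [_ _ ku]]] := @explore_stop #|V| finset.set0 g; first exact: max_card.
- exists c; apply/eqP; rewrite eqn_leq bud /= (leq_trans kc)// subset_leq_card//.
  by apply: finset.setSI; exact: final_sub.
- by exists (col u); apply/eqP; rewrite eqn_leq bud.
Qed.

(** With the final counts as budgets, no budget can stop the exploration early: the refused node
    would be in the final set but unexplored, so the budget of its community would not be full. *)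
Lemma explored_exact g :
  (forall b, #|final_active r g S :&: community b| = k b) ->
  explored g = final_active r g S.
Proof.
move=> kF; have F : explored g \subset final_active r g S.
  by apply: explore_final; exact: finset.sub0set.
apply/eqP; rewrite finset.eqEsubset F /=.
have [||[u [ua uB ku]]] := @explore_stop #|V| finset.set0 g; first exact: max_card.
  exact: final_sub.
exfalso.
have uF : u \in final_active r g S.
  exact: (fintype.subsetP (activated_final F)).
move: ku; rewrite -kF leqNgt => /negP; apply; apply: proper_card.
apply/properP; split; first exact: finset.setSI.
exists u; first by rewrite inE uF inE /=.
by rewrite inE (negPf uB).
Qed.


(** * The product martingale *)

Section Martingale.
Variables (R : realFieldType) (w : {set V} -> R) (W : bool -> R) (c : bool) (h0 : nat -> R) (h1 : R).
Hypothesis wE : forall u v, col v = c -> u != v -> w [set u; v]%SET = W (col u).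
Hypothesis h0E : forall m, (r <= m)%N -> h0 m = h1.

Definition flip_mean (x : R) (h : nat -> R) m := x * h m.+1 + (1 - x) * h m.

Lemma flip_meanC x y h : flip_mean x (flip_mean y h) = flip_mean y (flip_mean x h).
Proof. by apply: boolp.funext => m; rewrite /flip_mean; ring. Qed.

(* The mean of h0 at the final number of marks of a node with m marks, when s b
   nodes of each community b remain to be explored. *)
Definition mean_reward (s : bool -> nat) :=
  iter (s true) (flip_mean (W true)) (iter (s false) (flip_mean (W false)) h0).

Lemma iter_flip_meanC x y n h :
  iter n (flip_mean x) (flip_mean y h) = flip_mean y (iter n (flip_mean x) h).
Proof. by elim: n => //= n ->; rewrite flip_meanC. Qed.

(** The operators [flip_mean] commute, so the next exploration may come from either community. *)
Lemma mean_reward_step s t b : s b = (t b).+1 -> s (~~ b) = t (~~ b) ->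
  mean_reward s = flip_mean (W b) (mean_reward t).
Proof.
rewrite /mean_reward; case: b => /= -> -> //=.
by rewrite iter_flip_meanC.
Qed.

Lemma mean_reward_active s m : (r <= m)%N -> mean_reward s m = h1.
Proof.
have H n x h : (forall m, (r <= m)%N -> h m = h1) ->
    forall m, (r <= m)%N -> iter n (flip_mean x) h m = h1.
  move=> hh; elim: n => [|n IH i ri] /=; first exact: hh.
  by rewrite /flip_mean !IH ?leqW//; ring.
by apply/H/H.
Qed.

Definition budget A b := (k b - #|A :&: community b|)%N.

Definition potential A g : R :=
  \prod_(v in community c :\: S) mean_reward (budget A) (marks A g v).

Lemma ignores_marks e A : [disjoint e & A] ->
  ignores e (fun g => marks A g).
Proof.
move=> eA g; apply: boolp.funext => v; apply: eq_card => u; rewrite !inE.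
case: (boolP (u \in A)) => uA; last by rewrite !andbF.
suff /negPf-> : [set u; v]%SET != e by [].
by apply/eqP => E; move/pred0P: eA => /(_ u); rewrite /= uA -E !inE eqxx.
Qed.

(** The choice of the next node reads only edges with an end in [A]; an edge disjoint from [A] is
    still unrevealed. *)
Lemma ignores_next e A : [disjoint e & A] -> ignores e (next A).
Proof.
by move=> eA g; rewrite /next /activated (ignores_marks eA).
Qed.

Lemma marks_setU1 u A g v : u \notin A -> v != u ->
  marks (u |: A) g v = (marks A g v + ([set u; v]%SET \in g))%N.
Proof.
move=> uA vu; rewrite /marks finset.setIUr; case: (boolP ([set u; v]%SET \in g)) => E.
  rewrite (_ : _ :&: [set u] = [set u]); last first.
    by apply/finset.setIidPr; rewrite finset.sub1set !inE eq_sym vu E.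
  by rewrite finset.cardsU1 !inE (negPf uA) andbF /= addnC.
rewrite (_ : _ :&: [set u] = finset.set0) ?finset.set0U ?addn0//.
apply/setP => x; rewrite !inE; case: (eqVneq x u) => [->|_]; last by rewrite andbF.
by rewrite (negPf E) andbF.
Qed.

(* One more exploration: the edges from u to unexplored nodes are still fresh, and
   the factors of the explored nodes, already active, do not change any more. *)
Lemma potential_step u A (xi : {set {set V}} -> R) :
  u \notin A -> (#|A :&: community (col u)| < k (col u))%N ->
  (forall e : {set V}, [disjoint e & A] -> ignores e xi) ->
  (forall g, xi g != 0 -> u \in activated A g /\ A \subset activated A g) ->
  \sum_g bernoulli_mass w g * (xi g * potential (u |: A) g) =
  \sum_g bernoulli_mass w g * (xi g * potential A g).
Proof.
move=> uA ku ixi axi.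
pose D := community c :\: S.
have bud : budget A (col u) = (budget (u |: A) (col u)).+1.
  by rewrite /budget card_community_setU1// eqxx add1n subnSK.
have budN : budget A (~~ col u) = budget (u |: A) (~~ col u).
  by rewrite /budget card_community_setU1//; case: (col u).
have E := mean_reward_step bud budN.
pose F v g (b : bool) := mean_reward (budget (u |: A)) (marks A g v + b)%N.
pose s := enum (D :\: (u |: A)).
pose K := h1 ^+ #|D :&: (u |: A)|.
have sP v : v \in s -> [/\ v \in D, v \notin A, v != u & col v = c].
  rewrite mem_enum !inE negb_or => /andP[/andP[vu vA] /andP[vS /eqP cv]].
  by rewrite vu vA vS cv eqxx.
have split (f : V -> R) (xg : R) g : xi g != 0 ->
    (forall v, v \in D -> v \in u |: A -> f v = h1) ->
    \prod_(v in D) f v = K * \prod_(v <- s) f v.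
  move=> _ fh; rewrite (big_setID (u |: A))/= big_enum/=; congr (_ * _).
  rewrite (eq_bigr (fun=> h1)) ?prodr_const// => v.
  by rewrite inE => /andP[]; exact: fh.
(* A non-seed in [u |: A] is active only through its marks, so it has at least [r] of them and its
   factor is [h1]. *)
have act g v B : xi g != 0 -> A \subset B -> v \in D -> v \in u |: A -> (r <= marks B g v)%N.
  move=> xg AB vD vuA; have [ua Aa] := axi g xg.
  have : v \in activated A g.
    by move: vuA; rewrite finset.in_setU1 => /orP[/eqP->//|/(fintype.subsetP Aa)].
  move: vD; rewrite !inE => /andP[/negPf-> _] /= /leq_trans; apply.
  exact: marks_mono.
transitivity (\sum_g bernoulli_mass w g *
   ((xi g * K) * \prod_(v <- s) F v g ([set u; v]%SET \in g))).
  apply: eq_bigr => g _; congr (_ * _).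
  have [->|xg] := eqVneq (xi g) 0; first by rewrite !mul0r.
  rewrite -mulrA; congr (_ * _); rewrite /potential (split _ 0 g)//; last first.
    by move=> v vD vA; rewrite mean_reward_active// act// finset.subsetUr.
  congr (_ * _); rewrite !big_seq; apply: eq_bigr => v /sP[vD vA vu _].
  by rewrite /F marks_setU1.
rewrite bernoulli_indep.
- apply: eq_bigr => g _; congr (_ * _).
  have [->|xg] := eqVneq (xi g) 0; first by rewrite !mul0r.
  rewrite -mulrA; congr (_ * _); rewrite /potential (split _ 0 g)//; last first.
    by move=> v vD vA; rewrite mean_reward_active// act.
  congr (_ * _); rewrite !big_seq; apply: eq_bigr => v /sP[vD vA vu cv].
  by rewrite wE 1?eq_sym// /F E /flip_mean addn1 addn0.
- exact: enum_uniq.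
- move=> v v' /sP[_ _ vu _] _ /setP/(_ v); rewrite !inE eqxx orbT (negPf vu)/=.
  by move/esym/eqP.
- move=> v /sP[_ vA _ _] g; rewrite ixi//.
  apply/pred0P => x /=; rewrite !inE; apply/negP => /andP[/orP[]/eqP-> H];
    by rewrite H in uA vA *.
- move=> v v' b /sP[_ vA _ _] _ g; rewrite /F ignores_marks//.
  apply/pred0P => x /=; rewrite !inE; apply/negP => /andP[/orP[]/eqP-> H];
    by rewrite H in uA vA *.
Qed.

(** Optional stopping, by induction on the fuel. The weight [xi] carries the indicator of the
    history, which depends only on edges meeting [A]; generalising over it lets the explored nodes
    be random. *)
Lemma potential_explore j A (xi : {set {set V}} -> R) :
  (forall e : {set V}, [disjoint e & A] -> ignores e xi) ->
  (forall g, xi g != 0 -> A \subset activated A g) ->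
  \sum_g bernoulli_mass w g * (xi g * potential (explore j A g) g) =
  \sum_g bernoulli_mass w g * (xi g * potential A g).
Proof.
elim: j A xi => // j IH A xi ixi axi.
(* The sum is split by the value of the next node, and the corresponding indicator is absorbed into
   the weight. *)
have dec (X : {set {set V}} -> R) :
    \sum_g bernoulli_mass w g * (xi g * X g) =
    \sum_(o : option V) \sum_g bernoulli_mass w g * ((xi g * (next A g == o)%:R) * X g).
  rewrite exchange_big/=; apply: eq_bigr => g _; rewrite -mulr_sumr -mulr_suml -mulr_sumr.
  rewrite (bigD1 (next A g))//= eqxx big1 ?addr0 ?mulr1// => o /negPf.
  by rewrite eq_sym => ->.
rewrite !dec; apply: eq_bigr => -[u|] _; last first.
  apply: eq_bigr => g _ /=; case: eqP => [->//|_]; by rewrite mulr0 !mul0r.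
case: (boolP (u \in A)) => uA.
  apply: eq_bigr => g _; case: nextP => [v _|_]; last by rewrite mulr0 !mul0r.
  by case: eqP => [[->]|]; rewrite ?uA// mulr0 !mul0r.
case: (ltnP #|A :&: community (col u)| (k (col u))) => ku; last first.
  apply: eq_bigr => g _ /=; case: eqP => [->/=|_]; last by rewrite mulr0 !mul0r.
  by rewrite ltnNge ku.
pose xi' g := xi g * (next A g == Some u)%:R.
have ixi' e : [disjoint e & A] -> ignores e xi'.
  by move=> eA g; rewrite /xi' ixi// ignores_next.
have axi' g : xi' g != 0 -> u \in activated A g /\ A \subset activated A g.
  rewrite /xi' mulf_eq0 negb_or => /andP[/axi Aa E]; split=> //.
  move: E; case: nextP => [v va _|_]; last by rewrite /= eqxx.
  by case: (eqVneq (Some v) (Some u)) => [[<-]//|_]; rewrite /= eqxx.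
transitivity (\sum_g bernoulli_mass w g * (xi' g * potential (explore j (u |: A) g) g)).
  apply: eq_bigr => g _; rewrite /xi' /=; case: eqP => [->/=|_]; last by rewrite mulr0 !mul0r.
  by rewrite ku.
rewrite IH.
- exact: potential_step.
- move=> e eA; apply: ixi'; apply: disjointWr eA; exact: finset.subsetUr.
- move=> g /axi'[ua Aa]; apply: fintype.subset_trans (activated_mono g (finset.subsetUr [set u] A)).
  by rewrite finset.subUset finset.sub1set ua.
Qed.

(** The initial value: with nothing explored there are no marks and the whole budget remains, so all
    non-seeds contribute the same factor. *)
Lemma potential_explored :
  \sum_g bernoulli_mass w g * potential (explored g) g =
  (\sum_g bernoulli_mass w g) * mean_reward k 0 ^+ #|community c :\: S|.
Proof.
have /= E := @potential_explore #|V| finset.set0 (fun=> 1).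
under eq_bigr do rewrite -[potential _ _]mul1r.
rewrite -/(explored _) E => [|e _ g //|g _]; last exact: finset.sub0set.
rewrite mulr_suml; apply: eq_bigr => g _; congr (_ * _).
rewrite mul1r /potential -prodr_const; apply: eq_bigr => v _.
rewrite /marks finset.setI0 finset.cards0; congr (mean_reward _ _).
by apply: boolp.funext => b; rewrite /budget finset.set0I finset.cards0 subn0.
Qed.

End Martingale.

(** * Markov bounds from the martingale *)

Section Bounds.
Variables (R : realFieldType) (w : {set V} -> R) (W : bool -> R) (c : bool) (beta : R).
Hypothesis wE : forall u v, col v = c -> u != v -> w [set u; v]%SET = W (col u).
Hypothesis w01 : forall e, 0 <= w e <= 1.
Hypothesis W01 : forall b, 0 <= W b <= 1.
Hypothesis sum_mass : \sum_g bernoulli_mass w g = 1.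

Let reward m := if (r <= m)%N then beta else 1.

Lemma bernoulli_mass_ge0 g : 0 <= bernoulli_mass w g.
Proof.
by apply: prodr_ge0 => e _; case: ifP => _; rewrite ?subr_ge0; have /andP[] := w01 e.
Qed.

Lemma mean_reward_ge x s m : (forall m, x <= reward m) -> x <= mean_reward W reward s m.
Proof.
have H n p h : 0 <= p <= 1 -> (forall m, x <= h m) ->
    forall m, x <= iter n (flip_mean p) h m.
  move=> /andP[p0 p1] hh; elim: n => [|n IH] i /=; first exact: hh.
  by rewrite /flip_mean; have := IH i; have := IH i.+1; nra.
by move=> hh; apply/(H _ _ _ (W01 _))/(H _ _ _ (W01 _)).
Qed.

Let rewardE m : (r <= m)%N -> reward m = beta.
Proof. by rewrite /reward => ->. Qed.

(** On the event, each of the [k c] explored nodes of community [c] is a seed or carries the factor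
    [beta], and the factors of unexplored nodes are at least 1. So [beta] to the number of seeds,
    times the final potential, dominates [beta ^+ k c]. *)
Lemma reach_bound : 1 <= beta ->
  \sum_(g | #|explored g :&: community c| == k c) bernoulli_mass w g * beta ^+ k c <=
  beta ^+ #|S :&: community c| * mean_reward W reward k 0 ^+ #|community c :\: S|.
Proof.
move=> b1; rewrite -[X in _ * X]mul1r -sum_mass.
rewrite -(potential_explored wE rewardE) mulr_sumr big_mkcond/=; apply: ler_sum => g _.
have r1 s m : 1 <= mean_reward W reward s m.
  by apply: mean_reward_ge => i; rewrite /reward; case: ifP.
have b0 : 0 <= beta by apply: le_trans b1.
have m0 := bernoulli_mass_ge0 g.
case: ifP => [/eqP <-|_]; last first.
  rewrite !mulr_ge0 ?exprn_ge0//; apply: prodr_ge0 => v _; exact: le_trans (r1 _ _).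
rewrite mulrCA ler_wpM2l//; set A := explored g.
have AA : A \subset activated A g by apply: explore_activated; exact: finset.sub0set.
rewrite /potential (big_setID A)/=.
apply: (@le_trans _ _ (beta ^+ #|S :&: community c| * beta ^+ #|(community c :\: S) :&: A|)).
  rewrite -exprD ler_weXn2l//; apply: leq_trans (leq_card_setU _ _).
  apply/subset_leq_card/fintype.subsetP => v; rewrite !inE => /andP[-> ->].
  by rewrite !andbT orbN.
rewrite ler_wpM2l ?exprn_ge0// -[X in X <= _]mulr1 ler_pM ?exprn_ge0//.
  rewrite -prodr_const ler_prod// => v; rewrite !inE => /andP[/andP[vS _] vA].
  rewrite b0 (mean_reward_active _ rewardE) ?lexx//.
  by move: (fintype.subsetP AA _ vA); rewrite !inE (negPf vS).
by elim/big_ind: _ => // x y; exact: mulr_ege1.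
Qed.

(** On the event, the exploration covers exactly the final set and leaves no budget: active
    non-seeds contribute [beta] and inactive nodes 1. The potential is then known exactly, so
    [beta < 1] is allowed, which provides lower-tail bounds. *)
Lemma exact_bound : 0 < beta ->
  \sum_(g | [forall b, #|final_active r g S :&: community b| == k b])
    bernoulli_mass w g * beta ^+ k c <=
  beta ^+ #|S :&: community c| * mean_reward W reward k 0 ^+ #|community c :\: S|.
Proof.
move=> b0; rewrite -[X in _ * X]mul1r -sum_mass.
rewrite -(potential_explored wE rewardE) mulr_sumr big_mkcond/=; apply: ler_sum => g _.
have r0 s m : 0 <= mean_reward W reward s m.
  by apply: mean_reward_ge => i; rewrite /reward; case: ifP => // _; exact: ltW.
have m0 := bernoulli_mass_ge0 g.
case: ifP => [/forallP Fk|_]; last first.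
  apply: mulr_ge0; first exact/exprn_ge0/ltW.
  by apply: mulr_ge0 => //; exact: prodr_ge0.
have {}Fk b : #|final_active r g S :&: community b| = k b by apply/eqP.
rewrite mulrCA ler_wpM2l// /potential explored_exact//; set F := final_active _ _ _.
have FF : F \subset activated F g.
  rewrite /F -(explored_exact Fk); apply: explore_activated; exact: finset.sub0set.
rewrite (_ : budget F = fun=> 0%N); last first.
  by apply: boolp.funext => b; rewrite /budget Fk subnn.
rewrite (big_setID F)/= [X in _ * (_ * X)]big1 ?mulr1; last first.
  move=> v; rewrite !inE => /andP[vF _]; rewrite /mean_reward/= /reward ifF//.
  apply: contraNF vF => vF; apply: (fintype.subsetP (activated_final (fintype.subxx F))).
  by rewrite !inE vF orbT.
rewrite (eq_bigr (fun=> beta)) ?prodr_const; last first.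
  move=> v; rewrite !inE => /andP[/andP[vS _] vF]; rewrite /mean_reward/= rewardE//.
  by move: (fintype.subsetP FF _ vF); rewrite !inE (negPf vS).
rewrite -exprD -Fk -(finset.cardsID S (F :&: community c)).
rewrite (_ : _ :&: _ :&: S = S :&: community c); last first.
  rewrite -finset.setIA [community c :&: S]finset.setIC finset.setIA; congr (_ :&: _).
  by apply/finset.setIidPr; exact: sub_final.
by rewrite [F :&: _]finset.setIC finset.setIDAC lexx.
Qed.

End Bounds.

End Exploration.

(* The probability that the sum of a binomial (s, p) variable and of an
   independent binomial (t, q) variable is at least r. *)
Definition tail (R : realFieldType) r (p q : R) s t : R :=
  iter s (flip_mean p) (iter t (flip_mean q) (fun m => (r <= m)%:R)) 0.

(* E[beta^(a + X)] / beta^s for a binomial (n - a, tail r p q s t) variable X: Markov's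
   inequality for the number a + X of active nodes after (s, t) explorations. *)
Definition tilted_bound (R : realFieldType) r (beta : R) n a (p q : R) s t : R :=
  beta ^+ a * (1 + (beta - 1) * tail r p q s t) ^+ (n - a) / beta ^+ s.

Lemma iter_flip_mean_affine (R : realFieldType) (p x : R) n h :
  iter n (flip_mean p) (fun m => 1 + x * h m) =
  (fun m => 1 + x * iter n (flip_mean p) h m).
Proof.
elim: n => //= n ->; apply: boolp.funext => m; rewrite /flip_mean; ring.
Qed.

(** * Specialisation to the stochastic block model *)

Section SBM.
Variables (R : realType) (n1 n2 r : nat) (p1 p2 q : R).
Hypotheses (p1_01 : 0 <= p1 <= 1) (p2_01 : 0 <= p2 <= 1) (q_01 : 0 <= q <= 1).
Local Notation V := ('I_n1 + 'I_n2)%type.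
Local Notation final := (@final_active V r).

Definition side (v : V) : bool := if v is inl _ then true else false.

Lemma community_true : community side true = @community1 n1 n2.
Proof. by apply/setP => -[i|i]; rewrite !inE. Qed.

Lemma community_false : community side false = @community2 n1 n2.
Proof. by apply/setP => -[i|i]; rewrite !inE. Qed.

Lemma card_community1 : #|@community1 n1 n2| = n1.
Proof.
rewrite -[RHS]card_ord -(card_codom (@inl_inj 'I_n1 'I_n2)); apply: eq_card.
move=> [i|i]; rewrite inE; first by rewrite codom_f.
by apply/esym/negbTE/codomP => -[].
Qed.

Lemma card_community2 : #|@community2 n1 n2| = n2.
Proof.
rewrite -[RHS]card_ord -(card_codom (@inr_inj 'I_n1 'I_n2)); apply: eq_card.
move=> [i|i]; rewrite inE; last by rewrite codom_f.
by apply/esym/negbTE/codomP => -[].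
Qed.

Lemma sub_setU2 (u v : V) (C : {set V}) :
  ([set u; v]%SET \subset C) = (u \in C) && (v \in C).
Proof. by rewrite finset.subUset !finset.sub1set. Qed.

Definition prob_to c b : R := if c == b then (if c then p1 else p2) else q.

Lemma edge_probE c (u v : V) : side v = c -> u != v ->
  edge_prob p1 p2 q [set u; v]%SET = prob_to c (side u).
Proof.
move=> <- uv; rewrite /edge_prob cards2 uv/= !sub_setU2 !inE.
by case: u uv => u; case: v => v.
Qed.

Lemma prob_to_01 c b : 0 <= prob_to c b <= 1.
Proof. by rewrite /prob_to; case: eqP => _//; case: c. Qed.

Lemma edge_prob_01 (e : {set V}) : 0 <= edge_prob p1 p2 q e <= 1.
Proof. by rewrite /edge_prob; repeat case: ifP => _ //; rewrite lexx ler01. Qed.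

Variables (a1 a2 : nat) (S1 S2 : {set V}).
Hypotheses (S1C : S1 \subset @community1 n1 n2) (S1a : #|S1| = a1).
Hypotheses (S2C : S2 \subset @community2 n1 n2) (S2a : #|S2| = a2).
Let S := (S1 :|: S2)%SET.

Lemma seeds_community c : #|S :&: community side c|%SET = if c then a1 else a2.
Proof.
have D : (@community1 n1 n2 :&: @community2 n1 n2)%SET = finset.set0.
  by apply/setP => -[i|i]; rewrite !inE.
rewrite /S finset.setIUl; case: c; rewrite (community_true, community_false).
  rewrite (finset.setIidPl S1C) (_ : S2 :&: _ = finset.set0)%SET ?finset.setU0//.
  by apply/eqP; rewrite -finset.subset0 -D finset.setIC finset.setIS.
rewrite (finset.setIidPl S2C) (_ : S1 :&: _ = finset.set0)%SET ?finset.set0U//.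
by apply/eqP; rewrite -finset.subset0 -D finset.setSI.
Qed.

Lemma card_nonseeds c :
  #|community side c :\: S|%SET = if c then (n1 - a1)%N else (n2 - a2)%N.
Proof.
rewrite finset.cardsD finset.setIC seeds_community.
by case: c; rewrite (community_true, community_false) (card_community1, card_community2).
Qed.

(** The reward is 1 plus [beta - 1] times the indicator of at least [r] marks, and averaging is
    affine. *)
Lemma mean_reward_tail c (beta : R) k :
  mean_reward (prob_to c) (fun m => if (r <= m)%N then beta else 1) k 0 =
  1 + (beta - 1) * tail r (prob_to c c) q (k c) (k (~~ c)).
Proof.
rewrite (_ : (fun m => _) = (fun m : nat => 1 + (beta - 1) * (r <= m)%N%:R)); last first.
  by apply: boolp.funext => m; case: leqP; rewrite (mulr1, mulr0) ?addr0 1?addrC ?subrK.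
rewrite /mean_reward !iter_flip_mean_affine/tail; congr (1 + _ * _).
case: c; rewrite /prob_to//=.
have C x y n m h : iter n (flip_mean x) (iter m (flip_mean y) h) =
    iter m (flip_mean y) (iter n (flip_mean x) h) :> (nat -> R).
  by elim: m => //= m <-; rewrite iter_flip_meanC.
by rewrite C.
Qed.

Lemma sum_edge_mass : \sum_g bernoulli_mass (@edge_prob R n1 n2 p1 p2 q) g = 1.
Proof. exact: sum_sbm_mass. Qed.

Definition own (c : bool) (A : Type) (x y : A) := if c then x else y.

Lemma reach_chernoff (c : bool) (beta : R) k : 1 <= beta ->
  \sum_(g | #|explored r side k S g :&: community side c| == k c) sbm_mass p1 p2 q g <=
  tilted_bound r beta (own c n1 n2) (own c a1 a2) (own c p1 p2) q (k c) (k (~~ c)).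
Proof.
move=> b1; have b0 : 0 < beta by apply: lt_le_trans b1.
rewrite /tilted_bound ler_pdivlMr ?exprn_gt0// mulr_suml.
have H := @reach_bound _ r side k S R _ _ c beta (@edge_probE c) edge_prob_01
  (prob_to_01 c) sum_edge_mass b1; apply: le_trans H _.
rewrite mean_reward_tail seeds_community card_nonseeds /prob_to eqxx /own.
by case: c.
Qed.

Lemma exact_chernoff (c : bool) (beta : R) k : 0 < beta ->
  \sum_(g | [forall b, #|final g S :&: community side b| == k b]) sbm_mass p1 p2 q g <=
  tilted_bound r beta (own c n1 n2) (own c a1 a2) (own c p1 p2) q (k c) (k (~~ c)).
Proof.
move=> b0; rewrite /tilted_bound ler_pdivlMr ?exprn_gt0// mulr_suml.
have H := @exact_bound _ r side k S R _ _ c beta (@edge_probE c) edge_prob_01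
  (prob_to_01 c) sum_edge_mass b0; apply: le_trans H _.
rewrite mean_reward_tail seeds_community card_nonseeds /prob_to eqxx /own.
by case: c.
Qed.

(** A union bound. Either the exploration with budgets [(k1, k2)] fills one of them, or the final
    counts are some bad pair [(t1, t2)] below the budgets; each such pair is excluded by whichever
    community gives a small bound. *)
Lemma final_chernoff k1 k2 (E : {set {set V}} -> bool) (bad : nat -> nat -> bool)
    (beta1 beta2 u1 u2 l : R) :
  1 <= beta1 -> 1 <= beta2 ->
  tilted_bound r beta1 n1 a1 p1 q k1 k2 <= u1 ->
  tilted_bound r beta2 n2 a2 p2 q k2 k1 <= u2 ->
  0 <= l ->
  (forall t1 t2, (t1 < k1)%N -> (t2 < k2)%N -> bad t1 t2 ->
    (exists2 beta, 0 < beta & tilted_bound r beta n1 a1 p1 q t1 t2 <= l) \/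
    (exists2 beta, 0 < beta & tilted_bound r beta n2 a2 p2 q t2 t1 <= l)) ->
  (forall g, E g ->
    bad #|final g S :&: community side true|%SET #|final g S :&: community side false|%SET) ->
  \sum_(g | E g) sbm_mass p1 p2 q g <= u1 + u2 + k1%:R * k2%:R * l.
Proof.
move=> b1 b2 h1 h2 l0 hl hE.
pose k b := own b k1 k2.
pose T t1 t2 b := own b t1 t2 : nat.
pose ex t1 t2 g := [forall b, #|final g S :&: community side b|%SET == T t1 t2 b].
have m0 g : 0 <= sbm_mass p1 p2 q g := bernoulli_mass_ge0 edge_prob_01 g.
have l1 : \sum_(t1 < k1) \sum_(t2 < k2) l = k1%:R * k2%:R * l.
  by rewrite !sumr_const !card_ord -[LHS]mulr_natl -[X in _ * X]mulr_natl mulrA.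
rewrite -l1.
apply: (@le_trans _ _ (
  \sum_(g | #|explored r side k S g :&: community side true|%SET == k true) sbm_mass p1 p2 q g +
  \sum_(g | #|explored r side k S g :&: community side false|%SET == k false) sbm_mass p1 p2 q g +
  \sum_(t1 < k1) \sum_(t2 < k2) \sum_(g | bad t1 t2 && ex t1 t2 g) sbm_mass p1 p2 q g)); last first.
  apply: lerD; first apply: lerD.
  - by apply: le_trans h1; exact: (reach_chernoff true).
  - by apply: le_trans h2; exact: (reach_chernoff false).
  - apply: ler_sum => t1 _; apply: ler_sum => t2 _.
    case: (boolP (bad t1 t2)) => [b12|_]; last by rewrite big_pred0.
    have [||[b b0 H]|[b b0 H]] := hl t1 t2 _ _ b12; try exact: ltn_ord.
      by apply: le_trans H; exact: (@exact_chernoff true b (T t1 t2) b0).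
    by apply: le_trans H; exact: (@exact_chernoff false b (T t1 t2) b0).
rewrite [X in _ + X](_ : _ = \sum_g \sum_(t1 < k1) \sum_(t2 < k2)
    (if bad t1 t2 && ex t1 t2 g then sbm_mass p1 p2 q g else 0)); last first.
  rewrite [RHS]exchange_big/=; apply: eq_bigr => t1 _.
  by rewrite [RHS]exchange_big/=; apply: eq_bigr => t2 _; rewrite big_mkcond.
rewrite big_mkcond [X in X + _ + _]big_mkcond [X in _ + X + _]big_mkcond/= -!big_split/=.
apply: ler_sum => g _.
have s0 t1 : 0 <= \sum_(t2 < k2) (if bad t1 t2 && ex t1 t2 g then sbm_mass p1 p2 q g else 0).
  by apply: sumr_ge0 => t2 _; case: ifP.
have s00 (P : pred 'I_k1) : 0 <= \sum_(t1 < k1 | P t1) \sum_(t2 < k2)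
    (if bad t1 t2 && ex t1 t2 g then sbm_mass p1 p2 q g else 0).
  by apply: sumr_ge0 => t1 _.
case: (boolP (E g)) => Eg; last by do 2 (apply: addr_ge0 => //; try by case: ifP).
case: ifP => R1; first by rewrite -addrA lerDl addr_ge0//; case: ifP.
case: ifP => R2; first by rewrite add0r lerDl.
rewrite !add0r.
set t1 := #|final g S :&: community side true|%SET.
set t2 := #|final g S :&: community side false|%SET.
(* As neither budget is filled, [explored_reach] puts both final counts below the budgets, so this
   pair indexes a term of the double sum. *)
have nk b : (T t1 t2 b < k b)%N.
  rewrite ltnNge; apply/negP => kb.
  have [|[] bE] := @explored_reach _ r side k S g; first by exists b; case: b kb.
    by rewrite bE eqxx in R1.
  by rewrite bE eqxx in R2.
rewrite (bigD1 (Ordinal (nk true)))//= (bigD1 (Ordinal (nk false)))//=.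
rewrite hE//= (_ : ex t1 t2 g); last by apply/forallP => -[]; exact: eqxx.
by rewrite -addrA lerDl addr_ge0//; apply: sumr_ge0 => i _ //; case: ifP.
Qed.

Lemma card_final g : #|final g S| = (#|final g S :&: community side true|%SET +
  #|final g S :&: community side false|%SET)%N.
Proof.
rewrite -(finset.cardsID (community side true)); congr (_ + _)%N; apply: eq_card => v.
by rewrite !inE; case: (side v); rewrite andbC.
Qed.

End SBM.

(** Graph and seeds are independent, so a bound uniform over the admissible seed sets passes to the
    average; the seed masses sum to 1 because [a1 <= n1] and [a2 <= n2]. *)
Lemma sbm_prob_le (R : realType) n1 n2 (p1 p2 q : R) a1 a2
    (E : {set {set 'I_n1 + 'I_n2}} -> {set 'I_n1 + 'I_n2} -> bool) (B : R) :
  (a1 <= n1)%N -> (a2 <= n2)%N ->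
  (forall S1 S2 : {set 'I_n1 + 'I_n2}, S1 \subset @community1 n1 n2 -> #|S1| = a1 ->
     S2 \subset @community2 n1 n2 -> #|S2| = a2 ->
     \sum_(g | E g (S1 :|: S2)%SET) sbm_mass p1 p2 q g <= B) ->
  sbm_prob p1 p2 q a1 a2 E <= B.
Proof.
move=> an1 an2 H.
have sd C a (S : {set 'I_n1 + 'I_n2}) : 0 <= @seed_mass R n1 n2 C a S.
  by rewrite /seed_mass; case: ifP => // _; rewrite invr_ge0 ler0n.
rewrite /sbm_prob (_ : \sum_g _ = \sum_S1 \sum_S2 seed_mass R (@community1 n1 n2) a1 S1 *
    seed_mass R (@community2 n1 n2) a2 S2 * \sum_(g | E g (S1 :|: S2)%SET) sbm_mass p1 p2 q g).
  rewrite -[B]mul1r -(@sum_seed_mass R n1 n2 (@community1 n1 n2) a1) ?card_community1//.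
  rewrite mulr_suml; apply: ler_sum => S1 _.
  rewrite -[X in _ <= X]mul1r -(@sum_seed_mass R n1 n2 (@community2 n1 n2) a2) ?card_community2//.
  rewrite mulr_suml; apply: ler_sum => S2 _.
  rewrite mulrA [_ * seed_mass _ _ _ S1]mulrC.
  have [h1|h1] := boolP ((S1 \subset @community1 n1 n2) && (#|S1| == a1)); last first.
    by rewrite /seed_mass (negPf h1) !mul0r.
  have [h2|h2] := boolP ((S2 \subset @community2 n1 n2) && (#|S2| == a2)); last first.
    by rewrite /seed_mass (negPf h2) mulr0 !mul0r.
  rewrite ler_wpM2l ?mulr_ge0//.
  by move: h1 h2 => /andP[? /eqP ?] /andP[? /eqP ?]; exact: H.
rewrite exchange_big/=; apply: eq_bigr => S1 _.
rewrite (eq_bigr (fun g => \sum_S2 (if E g (S1 :|: S2)%SET then sbm_mass p1 p2 q g * seed_mass R (@community1 n1 n2) a1 S1 *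
    seed_mass R (@community2 n1 n2) a2 S2 else 0))); last by move=> g _; rewrite big_mkcond.
rewrite exchange_big/=; apply: eq_bigr => S2 _.
rewrite -big_mkcond/= mulr_sumr; apply: eq_bigr => g _; ring.
Qed.

From mathcomp Require Import all_classical all_reals all_analysis.
Import Order.TTheory GRing.Theory Num.Theory.
Import numFieldNormedType.Exports.
Local Open Scope classical_set_scope.
Local Open Scope ring_scope.

(** * Binomial tails *)

(** Convexity of the power, with the tangent taken at [v]. The induction step gains the square
    [k.+1%:R * v ^+ k * (u - v) ^+ 2]. *)
Lemma expr_tangent (R : realFieldType) (u v : R) k : 0 <= u -> 0 <= v ->
  v ^+ k.+1 + k.+1%:R * v ^+ k * (u - v) <= u ^+ k.+1.
Proof.
move=> u0 v0; elim: k => [|k IH]; first by rewrite !expr1 expr0; lra.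
rewrite [u ^+ _]exprS; apply: le_trans (ler_wpM2l u0 IH).
rewrite -subr_ge0 (_ : _ - _ = k.+1%:R * v ^+ k * (u - v) ^+ 2).
  by apply: mulr_ge0; rewrite ?sqr_ge0 ?mulr_ge0 ?exprn_ge0 ?ler0n.
by rewrite -[k.+2%:R]natr1 !exprS; ring.
Qed.

Section Tail.
Variables (R : realFieldType) (r : nat).
Implicit Types (p q : R) (h : nat -> R).

(** A Poisson-type bound: [x] is the mean number of further marks and [r - m] the number still
    missing. One more exploration is absorbed by the tangent inequality. *)
Let upper (x : R) m := x ^+ (r - m) / (r - m)`!%:R.

Let upper_step p (x : R) h : 0 <= p <= 1 -> 0 <= x ->
  (forall m, h m <= upper x m) -> forall m, flip_mean p h m <= upper (x + p) m.
Proof.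
move=> /andP[p0 p1] x0 hu m; rewrite /flip_mean.
apply: (@le_trans _ _ (p * upper x m.+1 + (1 - p) * upper x m)).
  by rewrite lerD// ler_wpM2l// subr_ge0.
rewrite /upper subnS; case: (r - m)%N => [|k] /=; first by rewrite !expr0; lra.
have f0 : 0 < k.+1`!%:R :> R by rewrite ltr0n fact_gt0.
have -> : x ^+ k / k`!%:R = k.+1%:R * x ^+ k / k.+1`!%:R.
  rewrite factS natrM; field; rewrite pnatr_eq0 -lt0n fact_gt0/=.
  by rewrite addrC natr1 pnatr_eq0.
have := expr_tangent k (addr_ge0 x0 p0) x0; rewrite [x + p - x]addrAC subrr add0r => H.
rewrite !mulrA -mulrDl ler_pM2r ?invr_gt0//; apply: le_trans H.
have : 0 <= p * x ^+ k.+1 by rewrite mulr_ge0 ?exprn_ge0.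
by move=> H; rewrite -subr_ge0 (_ : _ - _ = p * x ^+ k.+1)//; ring.
Qed.

(** Here [c] is the probability that no further mark occurs and [y] the mean number of them.
    Subtracting [M] per missing mark accounts for an exploration giving at most one mark. *)
Let lower (c y M : R) m := c * (Num.max 0 (y - (r - m)%:R * M) ^+ (r - m) / (r - m)`!%:R).

Let lower_step p (c y M : R) h : 0 <= p <= 1 -> p <= M -> 0 <= c ->
  (forall m, lower c y M m <= h m) ->
  forall m, lower ((1 - p) * c) (y + p) M m <= flip_mean p h m.
Proof.
move=> /andP[p0 p1] pM c0 hl m; rewrite /flip_mean.
apply: (@le_trans _ _ (p * lower c y M m.+1 + (1 - p) * lower c y M m)); last first.
  by rewrite lerD// ler_wpM2l// subr_ge0.
rewrite /lower subnS; case: (r - m)%N => [|k] /=.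
  by rewrite !expr0 fact0 !divr1 !mulr1; nra.
have f0 : 0 < k.+1`!%:R :> R by rewrite ltr0n fact_gt0.
set u := Num.max 0 (y - k%:R * M); set v := Num.max 0 (y - k.+1%:R * M).
set z := Num.max 0 (y + p - _).
have u0 : 0 <= u by rewrite /u le_max lexx.
have v0 : 0 <= v by rewrite /v le_max lexx.
have z0 : 0 <= z by rewrite /z le_max lexx.
have zv : z - v <= p.
  by rewrite /z /v -natr1; case: (lerP 0 (y + p - _)) => ?; case: (lerP 0 (y - _)) => ?; lra.
have zu : z <= u.
  rewrite /z /u ge_max le_max lexx/=; case: (lerP 0 (y - _)) => ?.
    by rewrite -natr1; lra.
  by rewrite -natr1; lra.
(* The tangent is taken at [z], since [z <= u] by [p <= M] and [z] exceeds [v] by at most [p]. *)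
have T := expr_tangent k v0 z0.
have zuk : z ^+ k <= u ^+ k by rewrite lerXn2r.
have -> : u ^+ k / k`!%:R = k.+1%:R * u ^+ k / k.+1`!%:R.
  rewrite factS natrM; field; rewrite pnatr_eq0 -lt0n fact_gt0/=.
  by rewrite addrC natr1 pnatr_eq0.
rewrite !mulrA -mulrDl ler_pM2r ?invr_gt0//.
have k0 : 0 <= k.+1%:R :> R by [].
have zk0 : 0 <= z ^+ k by rewrite exprn_ge0.
apply: (@le_trans _ _ (p * c * (k.+1%:R * z ^+ k) + (1 - p) * c * v ^+ k.+1)); last first.
  by rewrite lerD2r -!mulrA; do 3 (apply: ler_wpM2l => //).
have H1 : z ^+ k.+1 <= v ^+ k.+1 + p * (k.+1%:R * z ^+ k).
  have : 0 <= k.+1%:R * z ^+ k by rewrite mulr_ge0.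
  nra.
have c1 : 0 <= (1 - p) * c by rewrite mulr_ge0// subr_ge0.
apply: le_trans (ler_wpM2l c1 H1) _; rewrite mulrDr addrC lerD2r.
have : 0 <= p * c * (k.+1%:R * z ^+ k) by rewrite !mulr_ge0.
nra.
Qed.

Lemma tail_upper p q s t : 0 <= p <= 1 -> 0 <= q <= 1 ->
  tail r p q s t <= (s%:R * p + t%:R * q) ^+ r / r`!%:R.
Proof.
move=> p01 q01; have [p0 q0] : 0 <= p /\ 0 <= q by move: p01 q01 => /andP[? _] /andP[].
suff : forall m, iter s (flip_mean p) (iter t (flip_mean q) (fun m => (r <= m)%:R)) m <=
    upper (s%:R * p + t%:R * q) m by move=> /(_ 0%N); rewrite /upper subn0.
elim: s => [|s IH] /=; last first.
  move=> m; rewrite -[s.+1%:R]natr1 mulrDl mul1r addrAC; apply: upper_step => //.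
  by rewrite addr_ge0// mulr_ge0.
rewrite mul0r add0r; elim: t => [|t IH] /=; last first.
  by move=> m; rewrite -[t.+1%:R]natr1 mulrDl mul1r; apply: upper_step => //; rewrite mulr_ge0.
move=> m; rewrite mul0r /upper; case: leqP => rm.
  by rewrite (eqP rm) expr0 divr1.
by rewrite divr_ge0 ?exprn_ge0.
Qed.

Lemma tail_01 p q s t : 0 <= p <= 1 -> 0 <= q <= 1 -> 0 <= tail r p q s t <= 1.
Proof.
have st (x : R) h : 0 <= x <= 1 -> (forall m, 0 <= h m <= 1) -> forall m, 0 <= flip_mean x h m <= 1.
  move=> /andP[x0 x1] hh m; rewrite /flip_mean.
  by have := hh m; have := hh m.+1; move=> /andP[? ?] /andP[? ?]; apply/andP; split; nra.
move=> p01 q01; rewrite /tail.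
suff : forall m, 0 <= iter s (flip_mean p) (iter t (flip_mean q) (fun m => (r <= m)%:R)) m <= 1.
  exact.
elim: s => [|s IH] /=; last exact: (st _ _ p01 IH).
elim: t => [|t IH] /=; last exact: (st _ _ q01 IH).
by move=> m; case: leqP; rewrite ?lexx ?ler01.
Qed.

Lemma tail_lower p q M s t : 0 <= p <= 1 -> 0 <= q <= 1 -> p <= M -> q <= M ->
  (1 - (s%:R * p + t%:R * q)) *
    (Num.max 0 (s%:R * p + t%:R * q - r%:R * M) ^+ r / r`!%:R) <= tail r p q s t.
Proof.
move=> p01 q01 pM qM; have /andP[p0 p1] := p01; have /andP[q0 q1] := q01.
have P1 : 0 <= 1 - p by rewrite subr_ge0.
have Q1 : 0 <= 1 - q by rewrite subr_ge0.
(* Bernoulli's inequality. As both powers are at most 1, their product is at least their sum minus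
   1, hence the factor 1 minus the mean. *)
have bern (x : R) n : 0 <= 1 - x -> 1 - n%:R * x <= (1 - x) ^+ n.
  case: n => [|n] x1; first by rewrite expr0; lra.
  by apply: le_trans (expr_tangent n x1 ler01); rewrite !expr1n; lra.
suff H : forall m, lower ((1 - p) ^+ s * (1 - q) ^+ t) (s%:R * p + t%:R * q) M m <=
    iter s (flip_mean p) (iter t (flip_mean q) (fun m => (r <= m)%:R)) m.
  apply: le_trans (H 0%N); rewrite /lower subn0 ler_wpM2r//.
    by rewrite divr_ge0// exprn_ge0// le_max lexx.
  have := bern _ s P1; have := bern _ t Q1.
  have : (1 - p) ^+ s <= 1 by rewrite exprn_ile1// gerBl.
  have : (1 - q) ^+ t <= 1 by rewrite exprn_ile1// gerBl.
  nra.
elim: s => [|s IH] /=; last first.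
  move=> m; rewrite -[s.+1%:R]natr1 mulrDl mul1r addrAC exprS -mulrA; apply: lower_step => //.
  by rewrite mulr_ge0 ?exprn_ge0.
rewrite mul0r add0r expr0 mul1r; elim: t => [|t IH] /=; last first.
  move=> m; rewrite -[t.+1%:R]natr1 mulrDl mul1r exprS; apply: lower_step => //.
  by rewrite exprn_ge0.
move=> m; rewrite mul0r /lower expr0 mul1r; case: leqP => rm.
  by rewrite (eqP rm) expr0 divr1.
rewrite sub0r max_l; first by rewrite expr0n subn_eq0 leqNgt rm mul0r.
by rewrite oppr_le0 mulr_ge0// (le_trans p0).
Qed.

End Tail.

(** * Exponential form of the tilted bound *)

Section Chernoff.
Variable R : realType.

(** From [(1 - x) * expR x <= 1], since (1 - x)(1 + x + 2x^2) = 1 + x^2(1 - 2x) is at least 1.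
    Negative [x] are covered as well, which serves both tails. *)
Lemma expR_le_quad (x : R) : x <= 2^-1 -> expR x <= 1 + x + 2 * x ^+ 2.
Proof.
move=> x2.
have h : 1 - x <= expR (- x) by exact: expR_ge1Dx.
have e : expR (- x) = (expR x)^-1 by rewrite expRN.
have x1 : 0 < 1 - x by lra.
have E0 := expR_gt0 x.
have : (1 - x) * expR x <= 1.
  by rewrite -ler_pdivlMr// mul1r -e.
have : 1 <= (1 - x) * (1 + x + 2 * x ^+ 2) by nra.
move=> H1 H2; rewrite -(ler_pM2l x1); exact: le_trans H1.
Qed.

(** The inequality 1 + u <= exp u replaces the binomial generating function by that of a Poisson
    variable with the same mean [m]. *)
Lemma chernoff_le r (x : R) n a (p q : R) s t m :
  0 <= p <= 1 -> 0 <= q <= 1 -> x <= 2^-1 ->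
  m = (n - a)%:R * tail r p q s t ->
  tilted_bound r (expR x) n a p q s t <=
  expR (- (x * (s%:R - a%:R)) + (x + 2 * x ^+ 2) * m).
Proof.
move=> p01 q01 x2 mE; have /andP[t0 t1] := tail_01 r s t p01 q01.
have m0 : 0 <= m by rewrite mE mulr_ge0.
have b0 := expR_gt0 x.
rewrite /tilted_bound -!expRM_natl.
rewrite mulrAC -expRN -expRD (_ : a%:R * x + _ = - (x * (s%:R - a%:R))); last ring.
rewrite expRD ler_wpM2l ?expR_ge0//.
apply: (@le_trans _ _ (expR ((expR x - 1) * m))); last first.
  by rewrite ler_expR ler_wpM2r//; have := expR_le_quad x2; lra.
rewrite mE mulrCA expRM_natl lerXn2r ?nnegrE ?expR_ge0 ?expR_ge1Dx//.
nra.
Qed.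

End Chernoff.

(** * The limiting map *)

Section FixedPoint.
Variables (R : realType) (r : nat).
Hypothesis r2 : (2 <= r)%N.
Implicit Types (a h x y : R).

Definition rho_coef : R := r%:R^-1 * (1 - r%:R^-1) ^+ r.-1.

Let r_gt0 : 0 < r%:R :> R. Proof. by rewrite ltr0n (leq_trans _ r2). Qed.

Lemma rho_coef_gt0 : 0 < rho_coef.
Proof.
rewrite /rho_coef mulr_gt0 ?invr_gt0// exprn_gt0// subr_gt0 invf_lt1//.
by rewrite ltr1n.
Qed.

Lemma rho_mono a h x y x' y' : 0 <= h -> 0 <= x -> 0 <= y -> x <= x' -> y <= y' ->
  rho r a h x y + x <= rho r a h x' y' + x'.
Proof.
move=> h0 x0 y0 xx yy; rewrite /rho -/rho_coef.
have : rho_coef * (x + h * y) ^+ r <= rho_coef * (x' + h * y') ^+ r.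
  rewrite ler_wpM2l ?(ltW rho_coef_gt0)// lerXn2r ?nnegrE ?addr_ge0 ?mulr_ge0//.
  - exact: le_trans xx.
  - exact: le_trans yy.
  - by rewrite lerD// ler_wpM2l.
by lra.
Qed.

Lemma rho_smono a h x y y' : 0 < h -> 0 <= x -> 0 <= y -> y < y' ->
  rho r a h x y < rho r a h x y'.
Proof.
move=> h0 x0 y0 yy; rewrite /rho -/rho_coef ltrD2l ltr_pM2l ?rho_coef_gt0//.
rewrite ltrXn2r ?addr_ge0 ?mulr_ge0 ?(ltW h0)//; first by case: r r2.
by rewrite ltrD2l ltr_pM2l.
Qed.

(** The derivative of [rho + x] in its own coordinate; the derivative in the other coordinate is [h]
    times as large. *)
Definition rho_slope h x y := rho_coef * (r%:R * (x + h * y) ^+ r.-1).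

Lemma rho_tangent a h x y x' y' : 0 <= h -> 0 <= x -> 0 <= y -> 0 <= x' -> 0 <= y' ->
  rho r a h x y + x + rho_slope h x y * (x' - x + h * (y' - y)) <= rho r a h x' y' + x'.
Proof.
move=> h0 x0 y0 x0' y0'; rewrite /rho /rho_slope -/rho_coef.
have u0 : 0 <= x + h * y by rewrite addr_ge0// mulr_ge0.
have v0 : 0 <= x' + h * y' by rewrite addr_ge0// mulr_ge0.
have := expr_tangent r.-1 v0 u0; rewrite prednK ?(leq_trans _ r2)//.
have := rho_coef_gt0; set C := rho_coef; set U := (x + _) ^+ r; set W := (x + _) ^+ _.
set V := (_ + _) ^+ _; set d := _ - (x + h * y) => C0 H.
have -> : x' - x + h * (y' - y) = d by rewrite /d; ring.
have : C * (U + r%:R * W * d) <= C * V by rewrite ler_wpM2l// ltW.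
by lra.
Qed.

Lemma rho_slope_ge0 h x y : 0 <= h -> 0 <= x -> 0 <= y -> 0 <= rho_slope h x y.
Proof.
move=> h0 x0 y0; rewrite /rho_slope mulr_ge0 ?(ltW rho_coef_gt0)// mulr_ge0 ?(ltW r_gt0)//.
by rewrite exprn_ge0// addr_ge0// mulr_ge0.
Qed.

(** The tangent inequalities at the intermediate point towards both ends, weighted by [1 - t] and
    [t], have cancelling gradient terms. *)
Lemma rho_convex a h x y x' y' t : 0 <= h -> 0 <= x -> 0 <= y -> 0 <= x' -> 0 <= y' ->
  0 <= t <= 1 ->
  rho r a h (x + t * (x' - x)) (y + t * (y' - y)) <=
  (1 - t) * rho r a h x y + t * rho r a h x' y'.
Proof.
move=> h0 x0 y0 x0' y0' /andP[t0 t1].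
set u := x + _; set v := y + _.
have u0 : 0 <= u by rewrite /u; nra.
have v0 : 0 <= v by rewrite /v; nra.
have := rho_tangent a h0 u0 v0 x0 y0.
have := rho_tangent a h0 u0 v0 x0' y0'.
set l := rho_slope _ _ _; set A := rho _ _ _ u v; set B := rho _ _ _ x y.
set C := rho _ _ _ x' y' => H1 H2.
have : (1 - t) * (A + u + l * (x - u + h * (y - v))) <= (1 - t) * (B + x).
  by rewrite ler_wpM2l// subr_ge0.
have : t * (A + u + l * (x' - u + h * (y' - v))) <= t * (C + x').
  by rewrite ler_wpM2l.
rewrite /u /v => H3 H4.
suff E : (1 - t) * (A + u + l * (x - u + h * (y - v))) + t * (A + u + l * (x' - u + h * (y' - v))) =
  A + u by move: E; rewrite /u /v; lra.
rewrite /u /v; ring.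
Qed.

Variables (a1 a2 h1 h2 : R).
Hypotheses (a1_ge0 : 0 <= a1) (a2_ge0 : 0 <= a2) (h1_gt0 : 0 < h1) (h2_gt0 : 0 < h2).

Let pre : set (R * R) := [set x | [/\ 0 <= x.1, 0 <= x.2,
  rho r a1 h1 x.1 x.2 <= 0 & rho r a2 h2 x.2 x.1 <= 0]].

(* Knaster-Tarski: the infimum of the prefixed points is a fixed point. *)
Lemma least_zero (y : R * R) : pre y -> exists z : R * R,
  [/\ 0 <= z.1, 0 <= z.2, rho r a1 h1 z.1 z.2 = 0, rho r a2 h2 z.2 z.1 = 0 &
   forall w : R * R, 0 <= w.1 -> 0 <= w.2 -> rho r a1 h1 w.1 w.2 <= 0 ->
     rho r a2 h2 w.2 w.1 <= 0 -> z.1 <= w.1 /\ z.2 <= w.2].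
Proof.
move=> py.
pose P1 := fst @` pre; pose P2 := snd @` pre.
have lb1 : lbound P1 0 by move=> _ [x [? _ _ _] <-].
have lb2 : lbound P2 0 by move=> _ [x [_ ? _ _] <-].
have n1 : P1 !=set0 by exists y.1; exists y.
have n2 : P2 !=set0 by exists y.2; exists y.
have i1 : has_inf P1 by split => //; exists 0.
have i2 : has_inf P2 by split => //; exists 0.
pose z1 := inf P1; pose z2 := inf P2.
have z10 : 0 <= z1 by exact: lb_le_inf.
have z20 : 0 <= z2 by exact: lb_le_inf.
have le1 (x : R * R) : pre x -> z1 <= x.1.
  by move=> px; apply: ge_inf; [exists 0|exists x].
have le2 (x : R * R) : pre x -> z2 <= x.2.
  by move=> px; apply: ge_inf; [exists 0|exists x].
have f1 : rho r a1 h1 z1 z2 + z1 <= z1.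
  apply: lb_le_inf => // _ [x px <-]; have [x10 x20 p1 _] := px.
  apply: (@le_trans _ _ (rho r a1 h1 x.1 x.2 + x.1)); last by rewrite gerDr.
  by apply: rho_mono => //; [exact: ltW|exact: le1|exact: le2].
have f2 : rho r a2 h2 z2 z1 + z2 <= z2.
  apply: lb_le_inf => // _ [x px <-]; have [x10 x20 _ p2] := px.
  apply: (@le_trans _ _ (rho r a2 h2 x.2 x.1 + x.2)); last by rewrite gerDr.
  by apply: rho_mono => //; [exact: ltW|exact: le2|exact: le1].
have step_ge0 a h x y' : 0 <= a -> 0 < h -> 0 <= x -> 0 <= y' -> 0 <= rho r a h x y' + x.
  move=> a0 h0 x0 y0; rewrite /rho -/rho_coef.
  have : 0 <= rho_coef * (x + h * y') ^+ r.
    by rewrite mulr_ge0 ?(ltW rho_coef_gt0)// exprn_ge0// addr_ge0// mulr_ge0// ltW.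
  by lra.
(* The image [w] of the infimum under the monotone map is again a prefixed point, so the infimum is
   below [w] as well. *)
pose w := (rho r a1 h1 z1 z2 + z1, rho r a2 h2 z2 z1 + z2).
have pw : pre w.
  split => /=; [exact: step_ge0|exact: step_ge0| |].
    rewrite -(lerD2r w.1) add0r; apply: rho_mono => //=; [exact: ltW|exact: step_ge0|exact: step_ge0].
  rewrite -(lerD2r w.2) add0r; apply: rho_mono => //=; [exact: ltW|exact: step_ge0|exact: step_ge0].
exists (z1, z2); split => //=.
- by apply/eqP; rewrite eq_le; have := le1 _ pw; rewrite /w/=; move: f1; lra.
- by apply/eqP; rewrite eq_le; have := le2 _ pw; rewrite /w/=; move: f2; lra.
- by move=> x x10 x20 p1 p2; split; [exact: le1|exact: le2].
Qed.

Variables (y z : R * R).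
Hypotheses (z1_ge0 : 0 <= z.1) (z2_ge0 : 0 <= z.2).
Hypotheses (z1_zero : rho r a1 h1 z.1 z.2 = 0) (z2_zero : rho r a2 h2 z.2 z.1 = 0).
Hypotheses (zy1 : z.1 <= y.1) (zy2 : z.2 <= y.2).
Hypotheses (y1_neg : rho r a1 h1 y.1 y.2 < 0) (y2_neg : rho r a2 h2 y.2 y.1 < 0).

Lemma negative_above t : 0 < t <= 1 ->
  let u1 := z.1 + t * (y.1 - z.1) in let u2 := z.2 + t * (y.2 - z.2) in
  rho r a1 h1 u1 u2 < 0 /\ rho r a2 h2 u2 u1 < 0.
Proof.
move=> /andP[t0 t1] u1 u2.
have y10 : 0 <= y.1 by exact: le_trans zy1.
have y20 : 0 <= y.2 by exact: le_trans zy2.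
have t01 : 0 <= t <= 1 by rewrite ltW.
split.
- apply: le_lt_trans (rho_convex a1 (ltW h1_gt0) z1_ge0 z2_ge0 y10 y20 t01) _.
  by rewrite z1_zero mulr0 add0r pmulr_rlt0.
- apply: le_lt_trans (rho_convex a2 (ltW h2_gt0) z2_ge0 z1_ge0 y20 y10 t01) _.
  by rewrite z2_zero mulr0 add0r pmulr_rlt0.
Qed.

End FixedPoint.

(* With [d = y - z], convexity gives [DF(z) d <= F(y) - F(z)], strictly smaller
   than [d]; so [z - x] is compared with [d] at the index where the ratio of
   their coordinates is the largest. *)
Lemma zero_stable_ratio (R : realType) r (a1 h1 x1 x2 y1 y2 z1 z2 delta tau : R) :
  (2 <= r)%N -> 0 <= h1 -> 0 <= x1 -> 0 <= x2 -> 0 <= z1 -> 0 <= z2 ->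
  z1 <= y1 -> z2 <= y2 ->
  rho r a1 h1 z1 z2 = 0 -> rho r a1 h1 x1 x2 <= delta ->
  0 <= tau -> z1 - x1 = tau * (y1 - z1) -> z2 - x2 <= tau * (y2 - z2) ->
  tau * - rho r a1 h1 y1 y2 <= delta.
Proof.
move=> r2 h10 x10 x20 z10 z20 zy1 zy2 rz rx t0 e1 e2.
have y10 : 0 <= y1 by exact: le_trans zy1.
have y20 : 0 <= y2 by exact: le_trans zy2.
have := rho_tangent r2 a1 h10 z10 z20 x10 x20.
have := rho_tangent r2 a1 h10 z10 z20 y10 y20.
have := rho_slope_ge0 r2 h10 z10 z20.
rewrite rz add0r; set l := rho_slope _ _ _ _; move=> l0 H1 H2.
set A := rho _ _ _ y1 y2 in H1 *; set B := rho _ _ _ x1 x2 in rx H2.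
have H3 : tau * (z1 + l * (y1 - z1 + h1 * (y2 - z2))) <= tau * (A + y1) by rewrite ler_wpM2l.
have H4 : l * (- tau * (y1 - z1 + h1 * (y2 - z2))) <= l * (x1 - z1 + h1 * (x2 - z2)).
  rewrite ler_wpM2l// (_ : x1 - z1 = - tau * (y1 - z1)); last by lra.
  rewrite mulrDr lerD2l mulrCA ler_wpM2l//; lra.
have -> : tau * - A = - (tau * (A + y1)) + tau * y1 by ring.
have e1' : tau * y1 = z1 - x1 + tau * z1 by rewrite e1; ring.
rewrite e1'; move: H3 H4.
rewrite mulrDr [tau * (l * _)]mulrCA [- tau * _]mulNr [l * - _]mulrN.
set X := l * (tau * _); set Y := l * (x1 - _ + _) in H2 *; set Z := tau * (A + _).
lra.
Qed.

(** A quantitative stability of the least zero: a point where both drifts are at most [delta] lies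
    below [z] by no more than a multiple of [delta]. *)
Lemma zero_stable (R : realType) r (a1 a2 h1 h2 : R) (y z : R * R) :
  (2 <= r)%N -> 0 < h1 -> 0 < h2 -> 0 <= z.1 -> 0 <= z.2 ->
  rho r a1 h1 z.1 z.2 = 0 -> rho r a2 h2 z.2 z.1 = 0 -> z.1 < y.1 -> z.2 < y.2 ->
  rho r a1 h1 y.1 y.2 < 0 -> rho r a2 h2 y.2 y.1 < 0 ->
  exists2 K, 0 < K & forall delta x1 x2, 0 <= delta -> 0 <= x1 -> 0 <= x2 ->
    rho r a1 h1 x1 x2 <= delta -> rho r a2 h2 x2 x1 <= delta ->
    z.1 - K * delta <= x1 /\ z.2 - K * delta <= x2.
Proof.
move=> r2 h10 h20 z10 z20 rz1 rz2 zy1 zy2 ry1 ry2.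
have d1 : 0 < y.1 - z.1 by lra.
have d2 : 0 < y.2 - z.2 by lra.
pose kap := Num.min (- rho r a1 h1 y.1 y.2) (- rho r a2 h2 y.2 y.1).
have k0 : 0 < kap by rewrite lt_min !oppr_gt0 ry1.
have k1 : kap <= - rho r a1 h1 y.1 y.2 by rewrite ge_min lexx.
have k2 : kap <= - rho r a2 h2 y.2 y.1 by rewrite ge_min lexx orbT.
exists ((y.1 - z.1 + (y.2 - z.2)) / kap); first by rewrite divr_gt0// addr_gt0.
move=> delta x1 x2 de x10 x20 rx1 rx2.
pose t1 := (z.1 - x1) / (y.1 - z.1); pose t2 := (z.2 - x2) / (y.2 - z.2).
have e1 : z.1 - x1 = t1 * (y.1 - z.1) by rewrite divfK ?gt_eqF.
have e2 : z.2 - x2 = t2 * (y.2 - z.2) by rewrite divfK ?gt_eqF.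
(* [tau] is the largest of [t1], [t2] and 0. If positive, it is bounded by [zero_stable_ratio] in
   the community attaining it, where the drift at [y] is at most [- kap]. *)
suff [tau [H1 H2 H3]] : exists tau, [/\ t1 <= tau, t2 <= tau & 0 <= tau <= delta / kap].
  have /andP[t0 tk] := H3.
  rewrite -mulrA [_^-1 * _]mulrC mulrDl; set D := delta / kap in tk *.
  have D0 : 0 <= D by exact: le_trans tk.
  have : z.1 - x1 <= D * (y.1 - z.1).
    by rewrite e1 ler_wpM2r// ?(ltW d1)// (le_trans H1).
  have : z.2 - x2 <= D * (y.2 - z.2).
    by rewrite e2 ler_wpM2r// ?(ltW d2)// (le_trans H2).
  have : 0 <= D * (y.1 - z.1) by rewrite mulr_ge0// ltW.
  have : 0 <= D * (y.2 - z.2) by rewrite mulr_ge0// ltW.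
  by split; lra.
have dk : 0 <= delta / kap by rewrite divr_ge0// ltW.
have [t10|t10] := lerP t1 0; have [t20|t20] := lerP t2 0.
- by exists 0; rewrite lexx.
- exists t2; split => //; first by lra.
  rewrite (ltW t20)/= ler_pdivlMr//.
  apply: le_trans (zero_stable_ratio r2 (ltW h20) x20 x10 z20 z10 (ltW zy2) (ltW zy1)
    rz2 rx2 (ltW t20) e2 _); first by rewrite ler_wpM2l// ltW.
  by rewrite e1 ler_wpM2r ?(ltW d1)//; lra.
- exists t1; split => //; first by lra.
  rewrite (ltW t10)/= ler_pdivlMr//.
  apply: le_trans (zero_stable_ratio r2 (ltW h10) x10 x20 z10 z20 (ltW zy1) (ltW zy2)
    rz1 rx1 (ltW t10) e1 _); first by rewrite ler_wpM2l// ltW.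
  by rewrite e2 ler_wpM2r ?(ltW d2)//; lra.
- have [tt|tt] := lerP t1 t2.
    exists t2; split => //.
    rewrite (ltW t20)/= ler_pdivlMr//.
    apply: le_trans (zero_stable_ratio r2 (ltW h20) x20 x10 z20 z10 (ltW zy2) (ltW zy1)
      rz2 rx2 (ltW t20) e2 _); first by rewrite ler_wpM2l// ltW.
    by rewrite e1 ler_wpM2r ?(ltW d1).
  exists t1; split => //; first exact: ltW.
  rewrite (ltW t10)/= ler_pdivlMr//.
  apply: le_trans (zero_stable_ratio r2 (ltW h10) x10 x20 z10 z20 (ltW zy1) (ltW zy2)
    rz1 rx1 (ltW t10) e1 _); first by rewrite ler_wpM2l// ltW.
  by rewrite e2 ler_wpM2r ?(ltW d2)// ltW.
Qed.

(** * The subcritical condition and its zero *)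

Section Regions.
Variables (R : realType) (r : nat) (nu gamma mu alpha1 alpha2 : R).
Hypotheses (r2 : (2 <= r)%N) (nu_gt0 : 0 < nu) (gamma_gt0 : 0 < gamma) (mu_gt0 : 0 < mu).
Hypotheses (alpha1_gt0 : 0 < alpha1) (alpha2_ge0 : 0 <= alpha2).
Local Notation chi12 := (chi12 r nu gamma mu).
Local Notation chi21 := (chi21 r nu gamma mu).
Local Notation D := (domD r nu gamma mu).
Local Notation E1 := (E1 r nu gamma mu alpha1).
Local Notation E2 := (E2 r nu gamma mu alpha2).
Local Notation bound := (r%:R / r.-1%:R : R).

Lemma chi12_gt0 : 0 < chi12.
Proof. by rewrite mulr_gt0// powR_gt0// mulr_gt0// exprn_gt0. Qed.

Lemma chi21_gt0 : 0 < chi21.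
Proof. by rewrite mulr_gt0// powR_gt0// mulr_gt0. Qed.

Lemma domD_bound_gt0 : 0 < bound.
Proof. by case: r r2 => [|[|m]]// _; rewrite divr_gt0. Qed.

Lemma domD_le (x y : R * R) : D y -> 0 <= x.1 <= y.1 -> 0 <= x.2 <= y.2 -> D x.
Proof.
move=> [/andP[y1 y1b] /andP[y2 y2b] y12 y21] /andP[x1 xy1] /andP[x2 xy2].
have c1 : chi12 * x.2 <= chi12 * y.2 by rewrite ler_wpM2l// ltW// chi12_gt0.
have c2 : chi21 * x.1 <= chi21 * y.1 by rewrite ler_wpM2l// ltW// chi21_gt0.
by split; [apply/andP; split|apply/andP; split| |]; lra.
Qed.

(** A common interior point only gives non-positive drifts around it. Raising the other coordinate
    while staying in [E1], resp. [E2], makes them strictly negative, as each drift increases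
    strictly in the other coordinate. The point is first shrunk towards the origin to make room
    inside [domD]. *)
Lemma subcritical_negative :
  relative_interior r nu gamma mu E1 `&` relative_interior r nu gamma mu E2 !=set0 ->
  exists y : R * R, [/\ D y, rho r alpha1 chi12 y.1 y.2 < 0 & rho r alpha2 chi21 y.2 y.1 < 0].
Proof.
move=> [x []].
move=> /relative_interiorP[w []//|Dx [U1 [oU1 U1x UE1]]].
move=> /relative_interiorP[w []//|_ [U2 [oU2 U2x UE2]]].
have [e /= e0 eU] : exists2 e : R, 0 < e & ball x e `<=` U1 `&` U2.
  by apply/nbhs_ballP; apply: filterI; apply: open_nbhs_nbhs; split.
have [b b0 bE] : exists2 b : R, 0 < b & bound = b by exists bound => //; exact: domD_bound_gt0.
have c1 := chi12_gt0; have c2 := chi21_gt0.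
have [/andP[x1 x1b] /andP[x2 x2b] x12 x21] := Dx.
rewrite bE in x1b x2b x12 x21.
(* Shrinking by [1 - s] moves each coordinate by at most [s * b < e] and frees [s * b] in every
   constraint of [domD]. *)
pose s := Num.min 1 (e / (2 * b)).
have s0 : 0 < s by rewrite lt_min ltr01 divr_gt0// mulr_gt0.
have s1 : s <= 1 by rewrite ge_min lexx.
have sb : s * b < e.
  have : s <= e / (2 * b) by rewrite ge_min lexx orbT.
  by rewrite ler_pdivlMr ?mulr_gt0//; have := mulr_gt0 s0 b0; lra.
(* With this [h], raising both coordinates by up to [h] uses at most the freed room [s * b],
   whatever the constraint. *)
pose h := s * b / (1 + chi12 + chi21).
have hE : h + chi12 * h + chi21 * h = s * b.
  by rewrite /h; field; apply: lt0r_neq0; lra.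
have h0 : 0 < h by rewrite divr_gt0 ?mulr_gt0//; lra.
have ch1 : 0 < chi12 * h by rewrite mulr_gt0.
have ch2 : 0 < chi21 * h by rewrite mulr_gt0.
pose y := ((1 - s) * x.1, (1 - s) * x.2).
have s1x1 : 0 <= s * x.1 <= s * b by rewrite mulr_ge0 ?(ltW s0)//= ler_pM2l.
have s1x2 : 0 <= s * x.2 <= s * b by rewrite mulr_ge0 ?(ltW s0)//= ler_pM2l.
have y10 : 0 <= (1 - s) * x.1 by rewrite mulr_ge0// subr_ge0.
have y20 : 0 <= (1 - s) * x.2 by rewrite mulr_ge0// subr_ge0.
have y1b : (1 - s) * x.1 <= (1 - s) * b by rewrite ler_wpM2l// subr_ge0.
have y2b : (1 - s) * x.2 <= (1 - s) * b by rewrite ler_wpM2l// subr_ge0.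
have y12b : (1 - s) * (x.1 + chi12 * x.2) <= (1 - s) * b by rewrite ler_wpM2l// subr_ge0.
have y21b : (1 - s) * (x.2 + chi21 * x.1) <= (1 - s) * b by rewrite ler_wpM2l// subr_ge0.
have near u1 u2 : 0 <= u1 <= h -> 0 <= u2 <= h ->
    (U1 `&` U2) (y.1 + u1, y.2 + u2) /\ D (y.1 + u1, y.2 + u2).
  move=> /andP[u10 u1h] /andP[u20 u2h].
  have cu1 : chi21 * u1 <= chi21 * h by rewrite ler_pM2l.
  have cu2 : chi12 * u2 <= chi12 * h by rewrite ler_pM2l.
  move: s1x1 s1x2 => /andP[? ?] /andP[? ?].
  split.
    apply: eU; split; rewrite /ball/= /ball_/= ltr_norml /y/=; apply/andP; split; lra.
  rewrite /D/= /y/=; split; [apply/andP; split|apply/andP; split| |] => /=; rewrite ?bE; lra.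
have hh : 0 <= h <= h by apply/andP; split; lra.
have oh : (0 : R) <= 0 <= h by apply/andP; split; lra.
exists y; split.
- by have [_] := near 0 0 oh oh; rewrite !addr0.
- have [[U1y _] Dy] := near 0 h oh hh.
  have /= [_] := UE1 _ (conj U1y Dy); rewrite addr0; apply: lt_le_trans.
  by apply: rho_smono => //; rewrite ltrDl.
- have [[_ U2y] Dy] := near h 0 hh oh.
  have /= [_] := UE2 _ (conj U2y Dy); rewrite addr0; apply: lt_le_trans.
  by apply: rho_smono => //; rewrite ltrDl.
Qed.

Lemma subcritical_zero :
  relative_interior r nu gamma mu E1 `&` relative_interior r nu gamma mu E2 !=set0 ->
  exists z y : R * R,
   [/\ has_smallest_first (E1_tilde r nu gamma mu alpha1 `&` E2_tilde r nu gamma mu alpha2) z,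
    0 < z.1 /\ 0 <= z.2,
    rho r alpha1 chi12 z.1 z.2 = 0 /\ rho r alpha2 chi21 z.2 z.1 = 0,
    z.1 < y.1 /\ z.2 < y.2 &
    rho r alpha1 chi12 y.1 y.2 < 0 /\ rho r alpha2 chi21 y.2 y.1 < 0].
Proof.
move=> /subcritical_negative[y [Dy y1 y2]].
have [/andP[y10 _] /andP[y20 _] _ _] := Dy.
have c1 := chi12_gt0; have c2 := chi21_gt0.
have [|z [z10 z20 z1 z2 zmin]] :=
    @least_zero R r r2 alpha1 alpha2 chi12 chi21 (ltW alpha1_gt0) alpha2_ge0 c1 c2 y.
  by split => //; exact: ltW.
have [zy1 zy2] := zmin y y10 y20 (ltW y1) (ltW y2).
have above : forall a h u v u' v' : R, 0 < h -> 0 <= u -> 0 <= v -> u <= u' -> v <= v' ->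
    rho r a h u v = 0 -> rho r a h u' v' < 0 -> u < u'.
  move=> a h u v u' v' hh u0 v0 uu vv e1 e2.
  have := rho_mono r2 a (ltW hh) u0 v0 uu vv; lra.
exists z, y; split => //.
- split.
    by split; split => //; apply: (domD_le Dy); rewrite ?z10 ?z20.
  move=> w [[Dw w1] [_ w2]] wz.
  have [/andP[w10 _] /andP[w20 _] _ _] := Dw.
  have [zw1 zw2] : z.1 <= w.1 /\ z.2 <= w.2 by apply: zmin; rewrite ?w1 ?w2.
  (* A common zero with the same first coordinate and a larger second one would have a positive
     first drift. *)
  rewrite lt_neqAle zw1 andbT; apply/eqP => e1.
  have [e2|e2] := eqVneq z.2 w.2.
    by apply: wz; rewrite [w]surjective_pairing [z]surjective_pairing e1 e2.
  have : rho r alpha1 chi12 z.1 z.2 < rho r alpha1 chi12 z.1 w.2.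
    by apply: rho_smono => //; rewrite lt_neqAle e2.
  by rewrite z1 e1 w1 ltxx.
- split=> //.
  have : 0 <= rho_coef R r * (z.1 + chi12 * z.2) ^+ r.
    by rewrite mulr_ge0 ?(ltW (rho_coef_gt0 R r2))// exprn_ge0// addr_ge0// mulr_ge0// ltW.
  move: z1; rewrite /rho -/(rho_coef R r). by set X := _ * _ ^+ _; have := alpha1_gt0; lra.
- split.
  + exact: (above _ _ _ _ _ _ c1 z10 z20 zy1 zy2 z1 y1).
  + exact: (above _ _ _ _ _ _ c2 z20 z10 zy2 zy1 z2 y2).
Qed.

End Regions.

(** * Asymptotics *)

Section ChernoffExponent.
Variable R : realType.
Implicit Types (delta K G p q : R).

(** The tilt [x] is so small that the quadratic term costs at most half of the linear gain
    [x * delta * G]. *)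
Let quad (x d m delta K G : R) : 0 <= x -> 4 * (x * K) <= delta -> 0 <= G -> m <= K * G ->
  delta * G <= d -> - (x * d) + 2 * x ^+ 2 * m <= - (x * delta / 2 * G).
Proof.
move=> x0 xK G0 mK dG.
have : x * (delta * G) <= x * d by rewrite ler_wpM2l.
have : 2 * x ^+ 2 * m <= 2 * x ^+ 2 * (K * G) by rewrite ler_wpM2l// mulr_ge0// sqr_ge0.
have : 4 * (x * K) * (x * G) <= delta * (x * G) by rewrite ler_wpM2r// mulr_ge0.
rewrite expr2; lra.
Qed.

Let small_param delta K : 0 < delta -> 0 < K ->
  exists x : R, [/\ 0 < x, x <= 2^-1 & 4 * (x * K) <= delta].
Proof.
move=> d0 K0; exists (Num.min 2^-1 (delta / (4 * K))); split.
- by rewrite lt_min invr_gt0 ltr0n divr_gt0// mulr_gt0.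
- by rewrite ge_min lexx.
- rewrite mulrCA -ler_pdivlMr ?mulr_gt0//.
  by rewrite ge_min lexx orbT.
Qed.

Lemma chernoff_upper r delta K : 0 < delta -> 0 < K ->
  exists beta c, [/\ 1 <= beta, 0 < c &
    forall n a p q s t G, 0 <= p <= 1 -> 0 <= q <= 1 -> 0 <= G ->
      (n - a)%:R * tail r p q s t <= K * G ->
      delta * G <= s%:R - a%:R - (n - a)%:R * tail r p q s t ->
      tilted_bound r beta n a p q s t <= expR (- (c * G))].
Proof.
move=> d0 K0; have [x [x0 x2 xK]] := small_param d0 K0.
exists (expR x), (x * delta / 2); split.
- by rewrite -expR0 ler_expR ltW.
- by rewrite divr_gt0// mulr_gt0.
move=> n a p q s t G p01 q01 G0 mK dG.
apply: le_trans (@chernoff_le R r _ n a p q s t _ p01 q01 x2 erefl) _; rewrite ler_expR.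
apply: le_trans _ (quad (ltW x0) xK G0 mK dG); lra.
Qed.

Lemma chernoff_lower r delta K : 0 < delta -> 0 < K ->
  exists beta c, [/\ 0 < beta, 0 < c &
    forall n a p q s t G, 0 <= p <= 1 -> 0 <= q <= 1 -> 0 <= G ->
      (n - a)%:R * tail r p q s t <= K * G ->
      delta * G <= (n - a)%:R * tail r p q s t - (s%:R - a%:R) ->
      tilted_bound r beta n a p q s t <= expR (- (c * G))].
Proof.
move=> d0 K0; have [x [x0 x2 xK]] := small_param d0 K0.
exists (expR (- x)), (x * delta / 2); split.
- exact: expR_gt0.
- by rewrite divr_gt0// mulr_gt0.
move=> n a p q s t G p01 q01 G0 mK dG.
have nx2 : - x <= 2^-1 by lra.
apply: le_trans (@chernoff_le R r _ n a p q s t _ p01 q01 nx2 erefl) _; rewrite ler_expR.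
apply: le_trans _ (quad (ltW x0) xK G0 mK dG); rewrite sqrrN; lra.
Qed.

End ChernoffExponent.

(** * Scaling limit of the mean number of activated nodes *)

Section TailApprox.
Variables (R : realType) (r : nat).
Hypothesis r2 : (2 <= r)%N.

Let rK : r.-1.+1 = r. Proof. by rewrite prednK// (leq_trans _ r2). Qed.

(** The mean number of marks is [G * p * (x + hN * y)], with [hN] close to [h]; it is small, so the
    tail is nearly its [r]-th power over [r] factorial. The normalisation of [n%:R * (G * p) ^+ r]
    then produces [rho_coef]. The single parameter [eta] controls all errors uniformly in [s] and
    [t]. *)
Lemma tail_approx (h B delta : R) : 0 <= h -> 0 < B -> 0 < delta ->
  exists2 eta : R, 0 < eta &
  forall n a (p q G H : R) s t,
    0 < p <= 1 -> 0 <= q <= 1 -> 0 < G -> 0 < H -> (a <= n)%N ->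
    n%:R * (G * p) ^+ r = r`!%:R * (rho_coef R r * G) ->
    `|q * H / (p * G) - h| <= eta ->
    r%:R * (p + q) <= eta * (G * p) -> a%:R <= eta * n%:R -> G * p <= eta ->
    s%:R <= B * G -> t%:R <= B * H ->
    `|(n - a)%:R * tail r p q s t - G * (rho_coef R r * (s%:R / G + h * (t%:R / H)) ^+ r)|
      <= delta * G.
Proof.
move=> h0 B0 d0.
pose c := rho_coef R r; have c0 : 0 < c := rho_coef_gt0 R r2.
(* [W] bounds the rescaled mean with its error. In [L], the first term is the change of the [r]-th
   power, the second the loss from the factors [1 - eta] and [1 - eta * W]. *)
pose W := B * (2 + h).
have W0 : 0 < W by rewrite mulr_gt0//; lra.
have W0' := ltW W0.
pose L := r%:R * W ^+ r.-1 * (B + 1) + (1 + W) * W ^+ r.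
have L0 : 0 <= L.
  by rewrite addr_ge0// !mulr_ge0 ?exprn_ge0 ?addr_ge0 ?(ltW B0) ?(ltW W0).
have cL : 0 < c * L + 1 by rewrite ltr_wpDl// mulr_ge0// ltW.
exists (Num.min 1 (Num.min W^-1 (delta / (c * L + 1)))).
  by rewrite !lt_min ltr01 invr_gt0 W0 divr_gt0.
set eta := Num.min _ _.
have e1 : eta <= 1 by rewrite ge_min lexx.
have eW : eta * W <= 1 by rewrite -ler_pdivlMr// mul1r !ge_min lexx orbT.
have eL : eta * (c * L) <= delta.
  apply: (@le_trans _ _ (eta * (c * L + 1))); last first.
    by rewrite -ler_pdivlMr// !ge_min lexx !orbT.
  by rewrite ler_wpM2l ?lerDl// !le_min ler01 invr_ge0 (ltW W0) divr_ge0// ltW.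
have e0 : 0 <= eta by rewrite !le_min ler01 invr_ge0 (ltW W0) divr_ge0// ltW.
clearbody eta.
move=> n a p q G H s t /andP[p0 p1] q01 G0 H0 an nE; set hN := q * H / _ => hNh.
move=> rM aN Gp sB tB.
have /andP[q0 q1] := q01.
have p01 : 0 <= p <= 1 by rewrite ltW.
set x := s%:R / G; set y := t%:R / H.
have x0 : 0 <= x by rewrite divr_ge0// ltW.
have y0 : 0 <= y by rewrite divr_ge0// ltW.
have xB : x <= B by rewrite ler_pdivrMr.
have yB : y <= B by rewrite ler_pdivrMr.
set lam := s%:R * p + t%:R * q.
have lamE : lam = G * p * (x + hN * y).
  by rewrite /lam /x /y /hN; field; rewrite !gt_eqF.
have hN0 : 0 <= hN by rewrite divr_ge0 ?mulr_ge0 ?(ltW p0) ?(ltW G0) ?(ltW H0).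
move: hNh; rewrite ler_norml => /andP[hN1 hN2].
set w := x + h * y.
have hy0 : 0 <= h * y by rewrite mulr_ge0.
have hyB : h * y <= h * B by rewrite ler_wpM2l.
have ey : eta * y <= eta * B by rewrite ler_wpM2l.
have eB : eta * B <= B by rewrite ler_piMl// ltW.
have w0 : 0 <= w by rewrite addr_ge0.
have wW : w + eta * B <= W by rewrite /w /W; lra.
have hNy1 : hN * y <= (h + eta) * y by rewrite ler_wpM2r//; lra.
have hNy2 : (h - eta) * y <= hN * y by rewrite ler_wpM2r//; lra.
have Gp0 : 0 < G * p by rewrite mulr_gt0.
have u0 : 0 <= x + hN * y by rewrite addr_ge0// mulr_ge0.
have uW : x + hN * y <= w + eta * B by rewrite /w; lra.
have lamW : lam <= eta * W.
  by rewrite lamE ler_pM ?(ltW Gp0)// (le_trans uW).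
have f0 : 0 < r`!%:R :> R by rewrite ltr0n fact_gt0.
have n_E v : n%:R * ((G * p * v) ^+ r / r`!%:R) = c * G * v ^+ r.
  rewrite exprMn mulrA mulrA nE /c; field.
  by rewrite gt_eqF.
have W1 : 0 <= W ^+ r.-1 by rewrite exprn_ge0// ltW.
have Wr : 0 <= W ^+ r by rewrite exprn_ge0// ltW.
have up : (w + eta * B) ^+ r <= w ^+ r + eta * (r%:R * W ^+ r.-1 * (B + 1)).
  have eB0 : 0 <= eta * B by rewrite mulr_ge0// ltW.
  have wB0 : 0 <= w + eta * B by rewrite addr_ge0.
  have := expr_tangent r.-1 w0 wB0; rewrite rK => T.
  have : (w + eta * B) ^+ r.-1 <= W ^+ r.-1 by rewrite lerXn2r// nnegrE// ltW.
  set A := (w + _) ^+ r.-1 in T * => AW.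
  have : r%:R * (eta * B) * A <= r%:R * (eta * B) * W ^+ r.-1.
    by rewrite ler_wpM2l// mulr_ge0.
  have : 0 <= eta * (r%:R * W ^+ r.-1) by rewrite !mulr_ge0.
  lra.
(* The lower bound loses [eta * B] from the error on [h] and [eta] from the correction
   [r%:R * (p + q)]. *)
pose v := Num.max 0 (w - eta * (B + 1)).
have v0 : 0 <= v by rewrite le_max lexx.
have eB1 : 0 <= eta * (B + 1) by rewrite mulr_ge0// addr_ge0// ltW.
have vw : v <= w by rewrite ge_max w0/=; lra.
have vwe : w - v <= eta * (B + 1).
  have : w - eta * (B + 1) <= v by rewrite le_max lexx orbT.
  lra.
have low : w ^+ r - eta * (r%:R * W ^+ r.-1 * (B + 1)) <= v ^+ r.
  have := expr_tangent r.-1 v0 w0; rewrite rK => T.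
  have : w ^+ r.-1 <= W ^+ r.-1.
    rewrite lerXn2r// ?nnegrE ?(ltW W0)//; apply: le_trans wW; rewrite lerDl.
    by rewrite mulr_ge0// ltW.
  set A := w ^+ r.-1 in T * => AW.
  have A0 : 0 <= A by rewrite exprn_ge0.
  have : r%:R * A * (w - v) <= r%:R * W ^+ r.-1 * (eta * (B + 1)).
    by apply: ler_pM; rewrite ?mulr_ge0 ?subr_ge0// ler_wpM2l.
  lra.
have vW : v ^+ r <= W ^+ r.
  rewrite lerXn2r ?nnegrE ?(ltW W0)//; apply: le_trans vw _; apply: le_trans wW.
  by rewrite lerDl mulr_ge0// ltW.
have /andP[t0 t1] := tail_01 r s t p01 q01.
have na : (n - a)%:R <= n%:R :> R by rewrite ler_nat leq_subr.
have n0 : 0 <= n%:R :> R by [].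
have cG : 0 < c * G by rewrite mulr_gt0.
have U : (n - a)%:R * tail r p q s t <= c * G * (w + eta * B) ^+ r.
  apply: (@le_trans _ _ (n%:R * (lam ^+ r / r`!%:R))).
    by apply: ler_pM => //; exact: tail_upper.
  rewrite lamE n_E ler_wpM2l ?(ltW cG)// lerXn2r ?nnegrE// (le_trans u0)//.
have Lo : c * G * (v ^+ r - eta * ((1 + W) * W ^+ r)) <= (n - a)%:R * tail r p q s t.
  have M0 : p <= p + q by rewrite lerDl.
  have M1 : q <= p + q by rewrite lerDr ltW.
  have := tail_lower r s t p01 q01 M0 M1; rewrite -/lam => T.
  have lam1 : 0 <= 1 - lam by lra.
  have V : (G * p * v) ^+ r <= Num.max 0 (lam - r%:R * (p + q)) ^+ r.
    have Gv0 : 0 <= G * p * v by rewrite mulr_ge0// ltW.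
    rewrite lerXn2r ?nnegrE ?le_max ?lexx ?Gv0//.
    rewrite /v; have [vp|vn] := lerP 0 (w - eta * (B + 1)); last by rewrite mulr0 lexx.
    apply/orP; right.
    have : G * p * (w - eta * (B + 1)) <= G * p * (x + hN * y - eta).
      by rewrite ler_pM2l// /w; lra.
    by rewrite lamE; lra.
  have T1 : (1 - lam) * ((G * p * v) ^+ r / r`!%:R) <= tail r p q s t.
    by apply: le_trans T; rewrite ler_wpM2l// ler_pM2r ?invr_gt0.
  have X0 : 0 <= (G * p * v) ^+ r / r`!%:R.
    by rewrite divr_ge0// exprn_ge0// mulr_ge0// ltW.
  have nE2 : (n - a)%:R = n%:R - a%:R :> R by rewrite natrB.
  have e10 : 0 <= 1 - eta by lra.
  have T2 : (1 - eta) * n%:R * ((1 - eta * W) * ((G * p * v) ^+ r / r`!%:R)) <=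
      (n - a)%:R * tail r p q s t.
    apply: ler_pM.
    - by rewrite mulr_ge0.
    - by rewrite mulr_ge0// subr_ge0.
    - by rewrite nE2; lra.
    - apply: le_trans T1; rewrite ler_wpM2r//; lra.
  apply: le_trans T2.
  rewrite (_ : (1 - eta) * _ * _ = (1 - eta) * (1 - eta * W) * (n%:R * ((G * p * v) ^+ r / r`!%:R))); last by ring.
  rewrite n_E [leRHS]mulrCA ler_wpM2l ?(ltW cG)//.
  have vr0 : 0 <= v ^+ r by rewrite exprn_ge0.
  have : eta * (1 + W) * v ^+ r <= eta * (1 + W) * W ^+ r.
    by rewrite ler_wpM2l// mulr_ge0// addr_ge0// ltW.
  have : 0 <= eta * (eta * W) * v ^+ r by rewrite mulr_ge0// mulr_ge0// mulr_ge0.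
  lra.
have eL2 : c * G * (eta * L) <= delta * G.
  rewrite (_ : c * G * (eta * L) = eta * (c * L) * G); last by ring.
  by rewrite ler_wpM2r// ltW.
have P1 : 0 <= eta * (r%:R * W ^+ r.-1 * (B + 1)).
  by rewrite !mulr_ge0// addr_ge0// ltW.
have P2 : 0 <= eta * ((1 + W) * W ^+ r) by rewrite !mulr_ge0// addr_ge0// ltW.
rewrite (_ : G * _ = c * G * w ^+ r); last by rewrite /w /c; ring.
rewrite ler_norml; apply/andP; split.
  rewrite lerBrDr; apply: le_trans Lo.
  apply: (@le_trans _ _ (- (c * G * (eta * L)) + c * G * w ^+ r)); first by rewrite lerD2r lerN2.
  rewrite -mulrN -mulrDr ler_wpM2l ?(ltW cG)// /L; lra.
rewrite lerBlDr; apply: le_trans U _.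
apply: (@le_trans _ _ (c * G * (eta * L) + c * G * w ^+ r)); last by rewrite lerD2r.
rewrite -mulrDr ler_wpM2l ?(ltW cG)// /L; lra.
Qed.

End TailApprox.

Lemma cvg_powR (R : realType) (f : nat -> R) (l e : R) : 0 < l ->
  f N @[N --> \oo] --> l -> f N `^ e @[N --> \oo] --> l `^ e.
Proof.
move=> l0 fl; rewrite {2}/powR gt_eqF//.
have H : expR (e * ln (f N)) @[N --> \oo] --> expR (e * ln l).
  apply: continuous_cvg; first exact: continuous_expR.
  apply: cvgM; first exact: cvg_cst.
  apply: continuous_cvg => //; exact: continuous_ln.
apply: cvg_trans H; apply: near_eq_cvg; near=> N.
rewrite /powR gt_eqF//; near: N; exact: (cvgr_gt l fl).
Unshelve. all: by end_near. Qed.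

Lemma cvg_equivalentM (R : realType) (f g : nat -> R) (c : R) : c != 0 ->
  equivalent f (fun N => c * g N) -> f N / g N @[N --> \oo] --> c.
Proof.
move=> c0 fg; rewrite -[c in X in _ --> X]mulr1.
rewrite (_ : (fun N => f N / g N) = (fun N => c * (f N / (c * g N)))); last first.
  (* The identity also holds where [g N] vanishes, the inverse of 0 being 0. *)
  by apply/funext => N; rewrite invfM [RHS]mulrCA [c * (_ * _)]mulrA divff// mul1r.
by apply: cvgM => //; exact: cvg_cst.
Qed.

(** * Asymptotics of the critical seed numbers *)

Section CritSeeds.
Variables (R : realType) (r : nat).
Hypothesis r2 : (2 <= r)%N.
Implicit Types (n : nat) (p : R).

Let r1_gt0 : (0 < r.-1)%N. Proof. by case: r r2 => [|[]]. Qed.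

Let e : R := r.-1%:R^-1.

Let lead : R := (1 - r%:R^-1) ^+ r.-1 * (r.-1)`!%:R.

Let sub_gt0 : 0 < 1 - r%:R^-1 :> R.
Proof. by rewrite subr_gt0 invf_lt1 ?ltr1n// ltr0n (leq_trans _ r2). Qed.

Let lead_gt0 : 0 < lead.
Proof. by rewrite mulr_gt0 ?exprn_gt0// ltr0n fact_gt0. Qed.

Lemma crit_seeds_gt0 n p : (0 < n)%N -> 0 < p -> 0 < crit_seeds r n p.
Proof.
move=> n0 p0; rewrite mulr_gt0// powR_gt0// divr_gt0 ?ltr0n ?fact_gt0//.
by rewrite mulr_gt0 ?ltr0n// exprn_gt0.
Qed.

(** The defining equation of the critical number free of roots, from which its orders of magnitude
    are read off. *)
Let crit_pow n p : (0 < n)%N -> 0 < p ->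
  n%:R * p ^+ r * crit_seeds r n p ^+ r.-1 = lead.
Proof.
move=> n0 p0; rewrite /crit_seeds exprMn -[(_ `^ _) ^+ _]powR_mulrn ?powR_ge0// -powRrM.
have np : 0 < n%:R * p ^+ r by rewrite mulr_gt0 ?ltr0n// exprn_gt0.
rewrite mulVf ?pnatr_eq0 -?lt0n// powRr1; last by rewrite divr_ge0// ltW.
by rewrite mulrCA /lead; congr (_ * _); rewrite mulrC divfK// gt_eqF.
Qed.

Lemma crit_seedsE n p : (0 < n)%N -> 0 < p ->
  n%:R * (crit_seeds r n p * p) ^+ r = r`!%:R * (rho_coef R r * crit_seeds r n p).
Proof.
move=> n0 p0; have := crit_pow n0 p0; rewrite /lead /rho_coef.
have rK : r.-1.+1 = r by rewrite prednK// (leq_trans _ r2).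
have -> : r`!%:R = r%:R * (r.-1)`!%:R :> R by rewrite -natrM -{1}rK factS rK.
have r0 : r%:R != 0 :> R by rewrite pnatr_eq0 -lt0n (leq_trans _ r2).
set x := crit_seeds _ _ _; rewrite [(x * p) ^+ _]exprMn -[X in x ^+ X * _]rK [x ^+ _.+1]exprS.
set y := (1 - _) ^+ _; set z := x ^+ _ => E.
rewrite (_ : _ * (_ * _ * _) = x * (n%:R * p ^+ r * z)); last by ring.
by rewrite E; field.
Qed.

Variables (n : nat -> nat) (p : nat -> R).
Hypotheses (n_gt0 : \forall N \near \oo, (0 < n N)%N) (p_gt0 : \forall N \near \oo, 0 < p N).
Local Notation G N := (crit_seeds r (n N) (p N)).

(** The assumption says that [n * p ^+ r] tends to 0, while its product with the power [r.-1] of the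
    critical number is constant. *)
Lemma cvg_crit_seeds :
  much_smaller p (fun N => ((n N)%:R `^ (r%:R^-1))^-1) -> G N @[N --> \oo] --> +oo.
Proof.
move=> [_ up]; apply/cvgryPge => A0; pose A := Num.max A0 1.
have A1 : 0 < A by rewrite lt_max ltr01 orbT.
pose eps := Num.min 1 (lead / A ^+ r.-1).
have eps0 : 0 < eps by rewrite lt_min ltr01 divr_gt0// exprn_gt0.
have eps1 : eps <= 1 by rewrite ge_min lexx.
near=> N.
have n0 : (0 < n N)%N by near: N.
have p0 : 0 < p N by near: N.
have G0 := crit_seeds_gt0 n0 p0.
apply: (@le_trans _ _ A); first by rewrite le_max lexx.
have pn : p N * (n N)%:R `^ r%:R^-1 <= eps.
  have : `|p N / ((n N)%:R `^ r%:R^-1)^-1| <= eps by near: N; exact: (cvgr0Pnorm_le _).1.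
  by rewrite invrK => /(le_trans (ler_norm _)).
have npr : (n N)%:R * p N ^+ r <= eps.
  have -> : (n N)%:R * p N ^+ r = (p N * (n N)%:R `^ r%:R^-1) ^+ r.
    rewrite exprMn -[X in _ = _ * X]powR_mulrn ?powR_ge0// -powRrM mulVf.
      by rewrite powRr1// mulrC.
    by rewrite pnatr_eq0 -lt0n (leq_trans _ r2).
  apply: (@le_trans _ _ (eps ^+ r)).
    by rewrite lerXn2r// ?nnegrE ?(ltW eps0)// mulr_ge0 ?powR_ge0// ltW.
  rewrite -[leRHS]expr1 ler_wiXn2l ?(ltW eps0)// (leq_trans _ r2)//.
have := crit_pow n0 p0; set g := crit_seeds _ _ _ => E.
rewrite -(@ler_pXn2r _ r.-1)// ?nnegrE ?(ltW A1) ?(ltW G0)//.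
have A2 : 0 < A ^+ r.-1 by rewrite exprn_gt0.
have g2 : 0 <= g ^+ r.-1 by rewrite exprn_ge0// ltW.
have : lead <= lead / A ^+ r.-1 * g ^+ r.-1.
  rewrite -{1}E ler_wpM2r// (le_trans npr)// ge_min lexx orbT//.
by rewrite mulrAC ler_pdivlMr// ler_pM2l.
Unshelve. all: by end_near. Qed.

(** By [crit_pow], the power [r.-1] of this product is [lead] divided by [n * p]. *)
Lemma cvg_crit_seedsM :
  much_smaller (fun N => (n N)%:R^-1) p -> G N * p N @[N --> \oo] --> (0 : R).
Proof.
move=> [_ lo]; apply/cvgr0Pnorm_le => eps eps0; near=> N.
have n0 : (0 < n N)%N by near: N.
have p0 : 0 < p N by near: N.
have G0 := crit_seeds_gt0 n0 p0.
have Gp0 := mulr_ge0 (ltW G0) (ltW p0); rewrite ger0_norm//.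
have np : (n N)%:R^-1 / p N <= eps ^+ r.-1 / lead.
  have : `|(n N)%:R^-1 / p N| <= eps ^+ r.-1 / lead.
    by near: N; apply: (cvgr0Pnorm_le _).1 => //; rewrite divr_gt0// exprn_gt0.
  by move/(le_trans (ler_norm _)).
rewrite -(@ler_pXn2r _ r.-1)// ?nnegrE ?(ltW eps0)//.
have E := crit_pow n0 p0.
have rK : r.-1.+1 = r by rewrite prednK// (leq_trans _ r2).
have n0' : (n N)%:R != 0 :> R by rewrite pnatr_eq0 -lt0n.
have -> : (crit_seeds r (n N) (p N) * p N) ^+ r.-1 = lead * ((n N)%:R^-1 / p N).
  by rewrite -E -{3}rK exprS exprMn; field; rewrite n0' gt_eqF.
by rewrite mulrC -ler_pdivlMr.
Unshelve. all: by end_near. Qed.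

Lemma cvg_crit_seeds_div :
  much_smaller (fun N => (n N)%:R^-1) p -> G N / (n N)%:R @[N --> \oo] --> (0 : R).
Proof.
move=> lo; have [_ lo'] := lo.
rewrite -[X in _ --> X](mulr0 (0 : R)).
have H : crit_seeds r (n N) (p N) * p N * ((n N)%:R^-1 / p N) @[N --> \oo] --> (0 * 0 : R).
  by apply: cvgM => //; exact: cvg_crit_seedsM.
apply: cvg_trans H; apply: near_eq_cvg; near=> N.
have p0 : 0 < p N by near: N.
by rewrite /= -mulrA [p N * _]mulrC divfK// gt_eqF.
Unshelve. all: by end_near. Qed.

End CritSeeds.

Lemma cvg_crit_seeds_ratio (R : realType) r (n m : nat -> nat) (p q : nat -> R) (nu mu : R) :
  (2 <= r)%N -> 0 < nu -> 0 < mu ->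
  (\forall N \near \oo, (0 < n N)%N) -> (\forall N \near \oo, (0 < m N)%N) ->
  (\forall N \near \oo, 0 < p N) -> (\forall N \near \oo, 0 < q N) ->
  (n N)%:R / (m N)%:R @[N --> \oo] --> nu -> p N / q N @[N --> \oo] --> mu ->
  crit_seeds r (m N) (q N) / crit_seeds r (n N) (p N) @[N --> \oo] -->
    (nu * mu ^+ r) `^ r.-1%:R^-1.
Proof.
move=> r2 nu0 mu0 n0 m0 p0 q0 nm pq.
have H : (n N)%:R / (m N)%:R * (p N / q N) ^+ r @[N --> \oo] --> nu * mu ^+ r.
  apply: cvgM => //.
  exact: (@continuous_cvg _ _ _ _ _ _ (fun x : R => x ^+ r) mu (@exprn_continuous R r mu) pq).
have /(@cvg_powR R _ _ r.-1%:R^-1)/(_ H) H' : 0 < nu * mu ^+ r by rewrite mulr_gt0// exprn_gt0.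
apply: cvg_trans H'; apply: near_eq_cvg; near=> N.
have n0' : (0 < n N)%N by near: N.
have m0' : (0 < m N)%N by near: N.
have p0' : 0 < p N by near: N.
have q0' : 0 < q N by near: N.
have nR : 0 < (n N)%:R :> R by rewrite ltr0n.
have mR : 0 < (m N)%:R :> R by rewrite ltr0n.
have pR : 0 < p N ^+ r by rewrite exprn_gt0.
have qR : 0 < q N ^+ r by rewrite exprn_gt0.
have fR : 0 < (r.-1)`!%:R :> R by rewrite ltr0n fact_gt0.
rewrite /crit_seeds.
set X := (r.-1)`!%:R / (_ * q N ^+ r); set Y := (r.-1)`!%:R / (_ * p N ^+ r).
have Y0 : 0 < Y by rewrite divr_gt0// mulr_gt0.
have -> : (n N)%:R / (m N)%:R * (p N / q N) ^+ r = X / Y.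
  by rewrite /X /Y expr_div_n; field; rewrite !gt_eqF.
have X0 : 0 < X by rewrite divr_gt0// mulr_gt0.
have r1 : 1 - r%:R^-1 != 0 :> R.
  by rewrite subr_eq0 eq_sym invr_eq1 pnatr_eq1 gtn_eqF.
rewrite powRM ?invr_ge0 ?ltW// -[Y^-1]powR_inv1 ?ltW// -[(Y `^ (-1)) `^ _]powRrM mulN1r powRN.
by rewrite -mulf_div divff// mul1r.
Unshelve. all: by end_near. Qed.

(** * Chernoff bounds for one community along the sequence *)

Section Community.
Variables (R : realType) (r : nat).
Hypothesis r2 : (2 <= r)%N.
Variables (n a : nat -> nat) (p q H : nat -> R) (h g alpha : R).
Local Notation G N := (crit_seeds r (n N) (p N)).
Hypotheses (n_gt0 : \forall N \near \oo, (0 < n N)%N) (p_gt0 : \forall N \near \oo, 0 < p N).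
Hypotheses (H_gt0 : \forall N \near \oo, 0 < H N).
Hypotheses (p01 : forall N, 0 <= p N < 1) (q01 : forall N, 0 <= q N < 1).
Hypotheses (an : forall N, (a N <= n N)%N) (h_ge0 : 0 <= h) (alpha_ge0 : 0 <= alpha).
Hypotheses (lower : much_smaller (fun N => (n N)%:R^-1) p).
Hypotheses (upper : much_smaller p (fun N => ((n N)%:R `^ (r%:R^-1))^-1)).
Hypotheses (cvg_h : q N * H N / (p N * G N) @[N --> \oo] --> h).
Hypotheses (cvg_g : q N / p N @[N --> \oo] --> g).
Hypotheses (cvg_a : (a N)%:R / G N @[N --> \oo] --> alpha).

Let p01' N : 0 <= p N <= 1. Proof. by have /andP[-> /ltW->] := p01 N. Qed.
Let q01' N : 0 <= q N <= 1. Proof. by have /andP[-> /ltW->] := q01 N. Qed.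

Lemma community_tail (B delta : R) : 0 < B -> 0 < delta ->
  \forall N \near \oo, forall s t, s%:R <= B * G N -> t%:R <= B * H N ->
  `|(n N - a N)%:R * tail r (p N) (q N) s t -
    G N * (rho_coef R r * (s%:R / G N + h * (t%:R / H N)) ^+ r)| <= delta * G N.
Proof.
move=> B0 d0; have [eta e0 approx] := tail_approx r2 h_ge0 B0 d0.
near=> N.
have n0 : (0 < n N)%N by near: N.
have p0 : 0 < p N by near: N.
have H0 : 0 < H N by near: N.
have G0 := crit_seeds_gt0 r2 n0 p0.
(* Eventually [q <= (g + 1) * p], so this bound on [G N] gives [r%:R * (p + q) <= eta * (G * p)]. *)
have G1 : r%:R * (2 + g) / eta <= G N.
  by near: N; move/cvgryPge: (cvg_crit_seeds r2 n_gt0 p_gt0 upper); exact.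
move=> s t sB tB; apply: approx => //.
- by have /andP[_ ->] := p01' N; rewrite p0.
- exact: crit_seedsE.
- by near: N; exact: (cvgr_distC_le _ _ cvg_h).
- have qg : q N / p N <= g + 1 by near: N; apply: (cvgr_le _ cvg_g); rewrite ltrDl.
  rewrite ler_pdivrMr// in qg; rewrite ler_pdivrMr// in G1.
  have : r%:R * (p N + q N) <= r%:R * ((2 + g) * p N) by rewrite ler_wpM2l//; lra.
  by move/le_trans; apply; rewrite mulrA [leRHS]mulrA ler_pM2r// [leRHS]mulrC.
- have aG : (a N)%:R / G N <= alpha + 1 by near: N; apply: (cvgr_le _ cvg_a); rewrite ltrDl.
  have alpha1 : 0 < alpha + 1 by rewrite ltr_wpDl.
  have Gn : G N / (n N)%:R <= eta / (alpha + 1).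
    near: N; apply: (cvgr_le _ (cvg_crit_seeds_div r2 n_gt0 p_gt0 lower)).
    by rewrite divr_gt0// ltr_wpDl.
  have nR : 0 < (n N)%:R :> R by rewrite ltr0n.
  rewrite ler_pdivrMr// in aG.
  move: Gn; rewrite ler_pdivrMr// mulrAC ler_pdivlMr// => Gn.
  by apply: le_trans aG _; rewrite mulrC.
- by near: N; apply: (cvgr_le _ (cvg_crit_seedsM r2 n_gt0 p_gt0 lower)).
Unshelve. all: by end_near. Qed.

Lemma community_upper (Y1 Y2 : R) (s t : nat -> nat) :
  0 <= Y1 -> 0 <= Y2 -> rho r alpha h Y1 Y2 < 0 ->
  (s N)%:R / G N @[N --> \oo] --> Y1 -> (t N)%:R / H N @[N --> \oo] --> Y2 ->
  exists beta c, [/\ 1 <= beta, 0 < c & \forall N \near \oo,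
    tilted_bound r beta (n N) (a N) (p N) (q N) (s N) (t N) <= expR (- (c * G N))].
Proof.
move=> Y10 Y20 neg cs ct.
(* Of the limiting drift, four times [delta], one part each goes to convergence, to the tail
   approximation and to the seeds; one remains. *)
pose delta := - rho r alpha h Y1 Y2 / 4; have d0 : 0 < delta by rewrite divr_gt0 ?oppr_gt0.
pose B := Y1 + Y2 + 1; have B0 : 0 < B by rewrite ltr_wpDl// addr_ge0.
have [beta [c [b1 c0 bound]]] := chernoff_upper r d0 B0.
exists beta, c; split => //.
have crho : rho r alpha h ((s N)%:R / G N) ((t N)%:R / H N) @[N --> \oo] -->
    rho r alpha h Y1 Y2.
  apply: cvgD; first by apply: cvgB => //; exact: cvg_cst.
  apply: cvgM; first exact: cvg_cst.
  apply: (@continuous_cvg _ _ _ _ _ _ (fun x : R => x ^+ r)); first exact: exprn_continuous.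
  by apply: cvgD => //; apply: cvgM => //; exact: cvg_cst.
near=> N.
have n0 : (0 < n N)%N by near: N.
have p0 : 0 < p N by near: N.
have H0 : 0 < H N by near: N.
have G0 := crit_seeds_gt0 r2 n0 p0.
have sB : (s N)%:R <= B * G N.
  rewrite -ler_pdivrMr//; near: N; apply: (cvgr_le _ cs); rewrite /B; lra.
have tB : (t N)%:R <= B * H N.
  rewrite -ler_pdivrMr//; near: N; apply: (cvgr_le _ ct); rewrite /B; lra.
have ta : `|(n N - a N)%:R * tail r (p N) (q N) (s N) (t N) -
    G N * (rho_coef R r * ((s N)%:R / G N + h * ((t N)%:R / H N)) ^+ r)| <= delta * G N.
  by move: sB tB; near: N; apply: filterS (community_tail B0 d0) => N; exact.
have rN : rho r alpha h ((s N)%:R / G N) ((t N)%:R / H N) <= - (3 * delta).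
  near: N; apply: (cvgr_le _ crho); rewrite /delta; lra.
have aN : (a N)%:R / G N <= alpha + delta by near: N; apply: (cvgr_le _ cvg_a); rewrite ltrDl.
move: ta; rewrite ler_norml => /andP[_ ta].
rewrite ler_pdivrMr// in aN.
have : G N * rho r alpha h ((s N)%:R / G N) ((t N)%:R / H N) <= G N * - (3 * delta).
  by rewrite ler_pM2l.
rewrite /rho -/(rho_coef R r) mulrDr mulrBr [G N * (_ / _)]mulrC divfK ?gt_eqF//.
move: ta; set T := _ * tail _ _ _ _ _; set X := G N * (rho_coef _ _ * _) => ta rN'.
have dG : 0 < delta * G N by rewrite mulr_gt0.
have gap : delta * G N <= (s N)%:R - (a N)%:R - T by lra.
(* The gap is positive, so the mean [T] is at most [s N], hence at most [B * G N]. *)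
apply: bound => //; first exact: ltW.
have a0 : 0 <= (a N)%:R :> R by [].
by rewrite -/T; lra.
Unshelve. all: by end_near. Qed.

Lemma community_lower (B delta : R) : 0 < B -> 0 < delta ->
  exists beta c, [/\ 0 < beta, 0 < c & \forall N \near \oo, forall s t,
    s%:R <= B * G N -> t%:R <= B * H N ->
    delta <= rho r alpha h (s%:R / G N) (t%:R / H N) ->
    tilted_bound r beta (n N) (a N) (p N) (q N) s t <= expR (- (c * G N))].
Proof.
move=> B0 d0.
(* One third of the drift pays for the tail approximation, one for the seeds, and one is left for
   the exponent. *)
have d30 : 0 < delta / 3 by rewrite divr_gt0.
pose K := rho_coef R r * (B + h * B) ^+ r + delta / 3.
have K0 : 0 < K.
  rewrite ltr_wpDl// mulr_ge0 ?(ltW (rho_coef_gt0 R r2))// exprn_ge0//.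
  by rewrite addr_ge0 ?mulr_ge0 ?(ltW B0).
have [beta [c [b0 c0 bound]]] := chernoff_lower r d30 K0.
exists beta, c; split => //.
near=> N.
have n0 : (0 < n N)%N by near: N.
have p0 : 0 < p N by near: N.
have H0 : 0 < H N by near: N.
have G0 := crit_seeds_gt0 r2 n0 p0.
move=> s t sB tB rN.
have : `|(n N - a N)%:R * tail r (p N) (q N) s t -
    G N * (rho_coef R r * (s%:R / G N + h * (t%:R / H N)) ^+ r)| <= delta / 3 * G N.
  by move: s t sB tB {rN}; near: N; exact: community_tail.
have aN : alpha - delta / 3 <= (a N)%:R / G N.
  by near: N; apply: (cvgr_ge _ cvg_a); rewrite ltrBlDr ltrDl.
rewrite ler_norml => /andP[ta1 ta2].
rewrite ler_pdivlMr// in aN.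
have : G N * delta <= G N * rho r alpha h (s%:R / G N) (t%:R / H N) by rewrite ler_pM2l.
rewrite /rho -/(rho_coef R r) mulrDr mulrBr [G N * (_ / _)]mulrC divfK ?gt_eqF// => rN'.
apply: bound => //; first exact: ltW.
  rewrite /K mulrDl -lerBlDl; apply: le_trans ta2; rewrite lerD2l lerN2.
  rewrite [leRHS]mulrC ler_pM2l// ler_pM2l ?rho_coef_gt0//.
  have x0 : 0 <= s%:R / G N by rewrite divr_ge0// ltW.
  have y0 : 0 <= t%:R / H N by rewrite divr_ge0// ltW.
  have u0 : 0 <= s%:R / G N + h * (t%:R / H N) by rewrite addr_ge0// mulr_ge0.
  have v0 : 0 <= B + h * B by rewrite addr_ge0 ?mulr_ge0// ltW.
  rewrite lerXn2r//; apply: lerD; first by rewrite ler_pdivrMr.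
  by rewrite ler_wpM2l// ler_pdivrMr.
move: ta1 rN'; set T := _ * tail _ _ _ _ _; set X := G N * (rho_coef _ _ * _) => ta1 rN'.
lra.
Unshelve. all: by end_near. Qed.

End Community.

Lemma big_O_bounded (R : realType) (f g : nat -> R) (M : R) :
  (\forall N \near \oo, `|f N / g N| <= M) -> big_O f g.
Proof.
move=> fM; apply: (@le_lt_trans _ _ M%:E); last exact: ltry.
apply: ge_ereal_inf; exists (ereal_sup [set (`|f N / g N|)%:E | N in [set N | `|f N / g N| <= M]]).
  by exists [set N | `|f N / g N| <= M].
by apply: ge_ereal_sup => _ [N NM <-]; rewrite lee_fin.
Qed.

(** Half of the exponent absorbs the polynomial factor: for [b = c / 4 * G N], both 1 and [b ^+ 2]
    are at most [expR (b + b)]. *)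
Lemma big_O_expR (R : realType) (f G : nat -> R) (A c : R) :
  0 < c -> 0 <= A -> (forall N, 0 <= f N) -> (\forall N \near \oo, 0 < G N) ->
  (\forall N \near \oo, f N <= (2 + A * G N ^+ 2) * expR (- (c * G N))) ->
  big_O f (fun N => expR (- (c / 2 * G N))).
Proof.
move=> c0 A0 f0 G0 fA; apply: (@big_O_bounded _ _ _ (2 + A * (4 / c) ^+ 2)).
near=> N.
have GN : 0 < G N by near: N.
rewrite ger0_norm ?divr_ge0 ?expR_ge0// ler_pdivrMr ?expR_gt0//.
have H : f N <= (2 + A * G N ^+ 2) * expR (- (c * G N)) by near: N.
apply: (le_trans H).
pose b := c / 4 * G N.
have b0 : 0 <= b by rewrite mulr_ge0 ?divr_ge0// ltW.
have -> : - (c * G N) = - (b + b) + - (c / 2 * G N) by rewrite /b; field.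
rewrite expRD mulrA ler_wpM2r ?expR_ge0// expRN ler_pdivrMr ?expR_gt0//.
have -> : G N = 4 / c * b by rewrite /b; field; rewrite gt_eqF.
have be : b <= expR b by apply: le_trans (expR_ge1Dx b); rewrite lerDr.
have e1 : 1 <= expR (b + b) by rewrite -expR0 ler_expR addr_ge0.
have e2 : b ^+ 2 <= expR (b + b) by rewrite expRD expr2 ler_pM.
rewrite exprMn; set C := (4 / c) ^+ 2.
have C0 : 0 <= C by exact: sqr_ge0.
rewrite mulrDl lerD//; first by rewrite ler_peMr.
by rewrite mulrA ler_wpM2l// mulr_ge0.
Unshelve. all: by end_near. Qed.

Lemma cvg_truncnS (R : realType) (Y : R) (G : nat -> R) : 0 <= Y ->
  G N @[N --> \oo] --> +oo -> (Num.truncn (Y * G N)).+1%:R / G N @[N --> \oo] --> Y.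
Proof.
move=> Y0 Goo; apply/cvgrPdistC_le => e e0; near=> N.
have GN : e^-1 <= G N by near: N; move/cvgryPge: Goo; exact.
have G0 : 0 < G N by apply: lt_le_trans GN; rewrite invr_gt0.
have YG : 0 <= Y * G N by rewrite mulr_ge0// ltW.
have /andP[t1 t2] := truncn_itv YG.
set m := (Num.truncn _).+1%:R in t2 *.
rewrite (_ : m / G N - Y = (m - Y * G N) / G N); last by field; rewrite gt_eqF.
rewrite normrM normfV (gtr0_norm G0) ler_pdivrMr//.
have e1 : 1 <= e * G N by rewrite mulrC -ler_pdivrMr// div1r.
apply: le_trans e1.
rewrite ger0_norm; last by rewrite subr_ge0 ltW.
by rewrite /m -natr1; lra.
Unshelve. all: by end_near. Qed.

Lemma sbm_prob_ge0 (R : realType) n1 n2 (p1 p2 q : R) a1 a2 E :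
  0 <= p1 <= 1 -> 0 <= p2 <= 1 -> 0 <= q <= 1 ->
  0 <= @sbm_prob R n1 n2 p1 p2 q a1 a2 E.
Proof.
move=> p1_01 p2_01 q_01; rewrite /sbm_prob.
have sd C a S : 0 <= @seed_mass R n1 n2 C a S.
  by rewrite /seed_mass; case: ifP => // _; rewrite invr_ge0 ler0n.
apply: sumr_ge0 => g _; apply: sumr_ge0 => S1 _; apply: sumr_ge0 => S2 _.
rewrite mulr_ge0// mulr_ge0//.
exact: (bernoulli_mass_ge0 (@edge_prob_01 _ _ _ _ _ _ p1_01 p2_01 q_01)).
Qed.

Lemma lt_of_deviation (R : realFieldType) (v x e : R) :
  0 < e -> e < `|v - x| -> v <= x + e / 2 -> v < x - e.
Proof.
move=> e0; have [pos|neg] := lerP 0 (v - x); first by rewrite ger0_norm//; lra.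
by rewrite ltr0_norm//; lra.
Qed.

(** Here [k] is the limit and [u] the actual value of the ratio of the critical numbers; the
    coordinates and the ratio each cost a quarter of [e]. *)
Lemma combination_ge (R : realFieldType) (x1 x2 z1 z2 d k u e : R) :
  0 < k -> 0 < e -> z1 - d <= x1 -> z2 - d <= x2 -> 4 * (d * (1 + k)) = e ->
  x2 * (k - u) <= e / 4 -> z1 + z2 * k - e <= x1 + x2 * u.
Proof.
move=> k0 e0 h1 h2 de xk.
have : (z2 - d) * k <= x2 * k by rewrite ler_pM2r.
lra.
Qed.

Theorem theorem3p2 (R : realType) (r : nat)
    (n1 n2 a1 a2 : nat -> nat) (p1 p2 q : nat -> R)
    (nu gamma mu alpha1 alpha2 : R)
    (hr : (2 <= r)%N)
    (hn : forall n, (n1 n + n2 n)%N = n)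
    (hp1 : forall n, 0 <= p1 n < 1)
    (hp2 : forall n, 0 <= p2 n < 1)
    (hq : forall n, 0 <= q n < 1)
    (ha1 : forall n, (a1 n <= n1 n)%N)
    (ha2 : forall n, (a2 n <= n2 n)%N)
    (hnu : 0 < nu) (hgamma : 0 < gamma) (hmu : 0 < mu)
    (C_n : equivalent (fun n => (n1 n)%:R) (fun n => nu * (n2 n)%:R))
    (C_q : equivalent q (fun n => gamma * p1 n))
    (C_p : equivalent p1 (fun n => mu * p2 n))
    (C_p1_lower : much_smaller (fun n => (n1 n)%:R^-1) p1)
    (C_p1_upper : much_smaller p1 (fun n => ((n1 n)%:R `^ (r%:R^-1))^-1))
    (C_p2_lower : much_smaller (fun n => (n2 n)%:R^-1) p2)
    (C_p2_upper : much_smaller p2 (fun n => ((n2 n)%:R `^ (r%:R^-1))^-1))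
    (C_a1 : (a1 n)%:R / crit_seeds r (n1 n) (p1 n) @[n --> \oo] --> alpha1)
    (C_a2 : (a2 n)%:R / crit_seeds r (n2 n) (p2 n) @[n --> \oo] --> alpha2)
    (C_alpha2 : 0 <= alpha2) (C_alpha12 : alpha2 <= alpha1)
    (C_alpha1 : 0 < alpha1)
    (Sub : relative_interior r nu gamma mu (E1 r nu gamma mu alpha1) `&`
           relative_interior r nu gamma mu (E2 r nu gamma mu alpha2) !=set0) :
  exists z : R * R,
    has_smallest_first
      (E1_tilde r nu gamma mu alpha1 `&` E2_tilde r nu gamma mu alpha2) z /\
    let xstar := z.1 + z.2 * (nu * mu ^+ r) `^ (r.-1%:R^-1) in
    0 < xstar /\
    forall eps : R, 0 < eps ->
      exists c : R, 0 < c /\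
        big_O
          (fun n =>
             sbm_prob (p1 n) (p2 n) (q n) (a1 n) (a2 n)
               (fun (g : {set {set 'I_(n1 n) + 'I_(n2 n)}})
                    (S : {set 'I_(n1 n) + 'I_(n2 n)}) =>
                  eps < `| #|final_active r g S|%:R
                           / crit_seeds r (n1 n) (p1 n) - xstar |))
          (fun n => expR (- (c * crit_seeds r (n1 n) (p1 n)))).
Proof.
have hr1 : (0 < r.-1)%N by rewrite ltn_predRL.
have [z [y [smallest [z1 z2] [zz1 zz2] [zy1 zy2] [y1 y2]]]] :=
  subcritical_zero hr hnu hgamma hmu C_alpha1 C_alpha2 Sub.
exists z; split=> //=.
set kap := (nu * mu ^+ r) `^ _.
have kap0 : 0 < kap by rewrite powR_gt0// mulr_gt0// exprn_gt0.
have chi1 := chi12_gt0 r hnu hgamma hmu.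
have chi2 := chi21_gt0 r hnu hgamma hmu.
set xstar := z.1 + z.2 * kap.
split; first by rewrite /xstar ltr_pwDl// mulr_ge0// ltW.
move=> eps eps0.
pose G1 N := crit_seeds r (n1 N) (p1 N); pose G2 N := crit_seeds r (n2 N) (p2 N).
have ratio_n := cvg_equivalentM (lt0r_neq0 hnu) C_n.
have ratio_q := cvg_equivalentM (lt0r_neq0 hgamma) C_q.
have ratio_p := cvg_equivalentM (lt0r_neq0 hmu) C_p.
have npos : \forall N \near \oo, (0 < n1 N)%N /\ (0 < n2 N)%N.
  near=> N.
  (* Division by 0 gives 0, so a positive quotient makes both sizes positive. *)
  have : 0 < (n1 N)%:R / (n2 N)%:R :> R by near: N; exact: (cvgr_gt _ ratio_n).
  case: (n1 N) => [|m1]; first by rewrite mul0r ltxx.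
  by case: (n2 N) => [|m2] //; rewrite invr0 mulr0 ltxx.
have n1pos : \forall N \near \oo, (0 < n1 N)%N by apply: filterS npos => N [].
have n2pos : \forall N \near \oo, (0 < n2 N)%N by apply: filterS npos => N [].
have p1pos : \forall N \near \oo, 0 < p1 N.
  by apply: filterS C_p1_lower.1 => N; rewrite lt0r => ->; have /andP[] := hp1 N.
have p2pos : \forall N \near \oo, 0 < p2 N.
  by apply: filterS C_p2_lower.1 => N; rewrite lt0r => ->; have /andP[] := hp2 N.
have G1pos : \forall N \near \oo, 0 < G1 N.
  by apply: filterS2 n1pos p1pos => N; exact: crit_seeds_gt0.
have G2pos : \forall N \near \oo, 0 < G2 N.
  by apply: filterS2 n2pos p2pos => N; exact: crit_seeds_gt0.
have G1oo : G1 N @[N --> \oo] --> +oo := cvg_crit_seeds hr n1pos p1pos C_p1_upper.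
have G2oo : G2 N @[N --> \oo] --> +oo := cvg_crit_seeds hr n2pos p2pos C_p2_upper.
have ratio_G : G2 N / G1 N @[N --> \oo] --> kap.
  exact: cvg_crit_seeds_ratio.
have ratio_q2 : q N / p2 N @[N --> \oo] --> gamma * mu.
  have H : q N / p1 N * (p1 N / p2 N) @[N --> \oo] --> gamma * mu by apply: cvgM.
  apply: cvg_trans H; apply: near_eq_cvg; near=> N.
  have p10 : 0 < p1 N by near: N.
  by rewrite mulrA divfK// gt_eqF.
have lim12 : q N * G2 N / (p1 N * G1 N) @[N --> \oo] --> chi12 r nu gamma mu.
  rewrite (_ : (fun N => _) = (fun N => q N / p1 N * (G2 N / G1 N))).
    by rewrite /chi12 -/kap; exact: cvgM.
  by apply/funext => N; rewrite mulf_div.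
have lim21 : q N * G1 N / (p2 N * G2 N) @[N --> \oo] --> chi21 r nu gamma mu.
  rewrite (_ : (fun N => _) = (fun N => q N / p2 N * (G2 N / G1 N)^-1)).
    rewrite /chi21 (_ : gamma * _ = gamma * mu / kap).
      by apply: cvgM => //; apply: cvgV => //; rewrite gt_eqF.
    have numu : 0 < nu * mu by rewrite mulr_gt0.
    have -> : kap = (nu * mu) `^ r.-1%:R^-1 * mu.
      rewrite /kap -[X in mu ^+ X](prednK (leq_trans (ltnSn 0) (ltnW hr))) exprS mulrA.
      rewrite powRM ?exprn_ge0 ?ltW//; congr (_ * _).
      by rewrite -powR_mulrn ?ltW// -powRrM divff ?powRr1 ?ltW// pnatr_eq0 -lt0n.
    rewrite powRN; field; rewrite gt_eqF//= gt_eqF// powR_gt0//.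
  by apply/funext => N; rewrite invf_div mulf_div.
pose d1 := y.1 - z.1; pose d2 := y.2 - z.2.
have d10 : 0 < d1 by rewrite subr_gt0.
have d20 : 0 < d2 by rewrite subr_gt0.
have dd0 : 0 < d1 + d2 * kap by rewrite addr_gt0// mulr_gt0.
(* Going from [z] to [(Y1, Y2)] along the segment to [y] raises the limiting total by at most
   [eps / 4]. *)
pose t := Num.min 1 (eps / (4 * (d1 + d2 * kap))).
have t0 : 0 < t by rewrite lt_min ltr01 divr_gt0// mulr_gt0.
have t1 : t <= 1 by rewrite ge_min lexx.
have te : t * (4 * (d1 + d2 * kap)) <= eps.
  by rewrite -ler_pdivlMr ?mulr_gt0// ge_min lexx orbT.
pose Y1 := z.1 + t * d1; pose Y2 := z.2 + t * d2.
have t01 : 0 < t <= 1 by rewrite t0.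
have [rY1 rY2] := negative_above hr chi1 chi2 (ltW z1) z2 zz1 zz2 (ltW zy1) (ltW zy2) y1 y2 t01.
have Y10 : 0 <= Y1 by rewrite addr_ge0 ?(ltW z1)// mulr_ge0// ltW.
have Y20 : 0 <= Y2 by rewrite addr_ge0// mulr_ge0// ltW.
have Yx : Y1 + Y2 * kap <= xstar + eps / 4 by rewrite /Y1 /Y2 /xstar; lra.
(* The budgets are [Y1] and [Y2] in units of the critical numbers; the successor makes them exceed
   the real values and vanishes after rescaling. *)
pose k1 N := (Num.truncn (Y1 * G1 N)).+1; pose k2 N := (Num.truncn (Y2 * G2 N)).+1.
have ck1 : (k1 N)%:R / G1 N @[N --> \oo] --> Y1 by exact: cvg_truncnS.
have ck2 : (k2 N)%:R / G2 N @[N --> \oo] --> Y2 by exact: cvg_truncnS.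
have [b1 [c1 [b1_ge1 c1_gt0 up1]]] := community_upper hr n1pos p1pos G2pos hp1 hq ha1
  (ltW chi1) (ltW C_alpha1) C_p1_lower C_p1_upper lim12 ratio_q C_a1 Y10 Y20 rY1 ck1 ck2.
have [b2 [c2 [b2_ge1 c2_gt0 up2]]] := community_upper hr n2pos p2pos G1pos hp2 hq ha2
  (ltW chi2) C_alpha2 C_p2_lower C_p2_upper lim21 ratio_q2 C_a2 Y20 Y10 rY2 ck2 ck1.
have [K K0 stable] := zero_stable hr chi1 chi2 (ltW z1) z2 zz1 zz2 zy1 zy2 y1 y2.
(* With this [delta], the stability estimate costs exactly [eps / 4] in the total. *)
pose delta := eps / (4 * (K * (1 + kap))).
have delta0 : 0 < delta by rewrite divr_gt0// !mulr_gt0// addr_gt0.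
have Kd : 4 * (K * delta * (1 + kap)) = eps.
  by rewrite /delta; field; rewrite !gt_eqF ?addr_gt0.
pose B := Y1 + Y2 + 1.
have B0 : 0 < B by rewrite ltr_wpDl// addr_ge0.
have YB1 : Y1 < B by rewrite /B -addrA ltrDl ltr_wpDl.
have YB2 : Y2 < B by rewrite /B [Y1 + _]addrC -addrA ltrDl ltr_wpDl.
have [b3 [c3 [b3_gt0 c3_gt0 lo1]]] := community_lower hr n1pos p1pos G2pos hp1 hq ha1
  (ltW chi1) (ltW C_alpha1) C_p1_lower C_p1_upper lim12 ratio_q C_a1 B0 delta0.
have [b4 [c4 [b4_gt0 c4_gt0 lo2]]] := community_lower hr n2pos p2pos G1pos hp2 hq ha2
  (ltW chi2) C_alpha2 C_p2_lower C_p2_upper lim21 ratio_q2 C_a2 B0 delta0.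
(* The factor [kap / 2] converts rates in [G2] into rates in [G1], as eventually
   [kap / 2 * G1 <= G2]. *)
pose c := Num.min (Num.min c1 c3) (Num.min (c2 * (kap / 2)) (c4 * (kap / 2))).
have hk0 : 0 < kap / 2 by rewrite divr_gt0.
have hk1 : kap / 2 < kap by rewrite gtr_pMr// invf_lt1// ltr1n.
have hk2 : kap < kap + 1 by rewrite ltrDl.
have Yx' : Y1 + Y2 * kap < xstar + eps / 2.
  by apply: le_lt_trans Yx _; rewrite ltrD2l ltr_pM2l// ltf_pV2 ?posrE ?ltr_nat.
have c_gt0 : 0 < c by rewrite !lt_min c1_gt0 c3_gt0 !mulr_gt0.
exists (c / 2); split; first by rewrite divr_gt0.
apply: (@big_O_expR _ _ G1 (B * (B * (kap + 1))) c c_gt0).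
- apply: mulr_ge0; first exact: ltW.
  by apply: mulr_ge0; [exact: ltW|rewrite addr_ge0// ltW].
- move=> N; apply: sbm_prob_ge0.
  + by have /andP[-> /ltW->] := hp1 N.
  + by have /andP[-> /ltW->] := hp2 N.
  + by have /andP[-> /ltW->] := hq N.
- exact: G1pos.
have ev : \forall N \near \oo, [/\ 0 < G1 N, 0 < G2 N, (k1 N)%:R <= B * G1 N & (k2 N)%:R <= B * G2 N].
  near=> N.
  have g1 : 0 < G1 N by near: N; exact: G1pos.
  have g2 : 0 < G2 N by near: N; exact: G2pos.
  split => //; rewrite -ler_pdivrMr//; near: N; first exact: (cvgr_le _ ck1).
  exact: (cvgr_le _ ck2).
have evG : \forall N \near \oo, [/\ kap / 2 <= G2 N / G1 N, G2 N / G1 N <= kap + 1,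
    `|G2 N / G1 N - kap| <= eps / (4 * B) &
    (k1 N)%:R / G1 N + (k2 N)%:R / G2 N * (G2 N / G1 N) <= xstar + eps / 2].
  near=> N; split; near: N.
  - exact: (cvgr_ge _ ratio_G).
  - exact: (cvgr_le _ ratio_G).
  - by apply: (cvgr_distC_le _ _ ratio_G); rewrite divr_gt0// mulr_gt0.
  - apply: (cvgr_le (Y1 + Y2 * kap)); last exact: Yx'.
    by apply: cvgD => //; exact: cvgM.
apply: (filter_app _ _ lo2); apply: (filter_app _ _ lo1).
apply: (filter_app _ _ up2); apply: (filter_app _ _ up1); apply: (filter_app _ _ evG).
apply: filterS ev => N [g1 g2 kB1 kB2] [gg1 gg2 gg3 kk] u1 u2 l1 l2.
rewrite ler_pdivlMr// in gg1; rewrite ler_pdivrMr// in gg2.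
apply: (@le_trans _ _ (expR (- (c * G1 N)) + expR (- (c * G1 N)) +
  (k1 N)%:R * (k2 N)%:R * expR (- (c * G1 N)))); last first.
  rewrite -[X in X + X]mul1r -!mulrDl ler_wpM2r ?expR_ge0// lerD// expr2 mulrACA.
  apply: ler_pM => //; apply: (le_trans kB2).
  by rewrite -mulrA ler_pM2l.
have cexp (c' : R) (G' : R) : c * G1 N <= c' * G' -> expR (- (c' * G')) <= expR (- (c * G1 N)).
  by rewrite ler_expR lerN2.
have cG1 : c * G1 N <= c1 * G1 N by rewrite ler_pM2r// !ge_min lexx.
have cG3 : c * G1 N <= c3 * G1 N by rewrite ler_pM2r// !ge_min lexx orbT.
have cG2 : c * G1 N <= c2 * G2 N.
  apply: (@le_trans _ _ (c2 * (kap / 2) * G1 N)); last by rewrite -mulrA ler_pM2l.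
  by rewrite ler_pM2r// !ge_min lexx !orbT.
have cG4 : c * G1 N <= c4 * G2 N.
  apply: (@le_trans _ _ (c4 * (kap / 2) * G1 N)); last by rewrite -mulrA ler_pM2l.
  by rewrite ler_pM2r// !ge_min lexx !orbT.
have v1 := le_trans u1 (cexp _ _ cG1).
have v2 := le_trans u2 (cexp _ _ cG2).
have v3 s1 s2 H1 H2 H3 := le_trans (l1 s1 s2 H1 H2 H3) (cexp _ _ cG3).
have v4 s1 s2 H1 H2 H3 := le_trans (l2 s1 s2 H1 H2 H3) (cexp _ _ cG4).
move: v1 v2 v3 v4 (expR_ge0 (- (c * G1 N))) => {u1 u2 l1 l2 cexp}.
move: (expR _) => bnd v1 v2 v3 v4 bnd0.
have p1_01 : 0 <= p1 N <= 1 by have /andP[-> /ltW->] := hp1 N.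
have p2_01 : 0 <= p2 N <= 1 by have /andP[-> /ltW->] := hp2 N.
have q_01 : 0 <= q N <= 1 by have /andP[-> /ltW->] := hq N.
apply: sbm_prob_le => // S1 S2 S1C S1a S2C S2a.
pose bad s t := eps < `|(s + t)%:R / G1 N - xstar|.
apply: (@final_chernoff _ _ _ _ _ _ _ p1_01 p2_01 q_01 _ _ _ _ S1C S1a S2C S2a
  (k1 N) (k2 N) _ bad b1 b2 bnd bnd bnd b1_ge1 b2_ge1 v1 v2 bnd0).
- move=> s1 s2 sk1 sk2; rewrite /bad natrD => dev.
  have s1B : s1%:R / G1 N <= (k1 N)%:R / G1 N by rewrite ler_pM2r ?invr_gt0// ler_nat ltnW.
  have s2B : s2%:R / G2 N <= (k2 N)%:R / G2 N by rewrite ler_pM2r ?invr_gt0// ler_nat ltnW.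
  set x1 := s1%:R / G1 N in s1B *; set x2 := s2%:R / G2 N in s2B *.
  have x10 : 0 <= x1 by rewrite divr_ge0// ltW.
  have x20 : 0 <= x2 by rewrite divr_ge0// ltW.
  have xE : (s1%:R + s2%:R) / G1 N = x1 + x2 * (G2 N / G1 N).
    by rewrite /x1 /x2; field; rewrite !gt_eqF.
  have xle : x1 + x2 * (G2 N / G1 N) <= xstar + eps / 2.
    by apply: le_trans kk; rewrite lerD// ler_wpM2r// divr_ge0// ltW.
  have s1B' : s1%:R <= B * G1 N by apply: le_trans kB1; rewrite ler_nat ltnW.
  have s2B' : s2%:R <= B * G2 N by apply: le_trans kB2; rewrite ler_nat ltnW.
  (* Counts below the budgets cannot exceed the total by more than [eps / 2], so the deviation is
     downwards; were both drifts below [delta], stability would rule it out. *)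
  rewrite xE in dev; have low := lt_of_deviation eps0 dev xle.
  have [h1|h1] := lerP delta (rho r alpha1 (chi12 r nu gamma mu) x1 x2).
    by left; exists b3; last exact: v3.
  have [h2|h2] := lerP delta (rho r alpha2 (chi21 r nu gamma mu) x2 x1).
    by right; exists b4; last exact: v4.
  exfalso; have [e1 e2] := stable delta x1 x2 (ltW delta0) x10 x20 (ltW h1) (ltW h2).
  have x2B : x2 <= B by rewrite ler_pdivrMr.
  have e4 : x2 * `|G2 N / G1 N - kap| <= B * (eps / (4 * B)) by rewrite ler_pM.
  have e5 : B * (eps / (4 * B)) = eps / 4 by field; rewrite gt_eqF.
  have e6 : x2 * (kap - G2 N / G1 N) <= eps / 4.
    by rewrite -e5; apply: le_trans e4; rewrite ler_wpM2l// distrC ler_norm.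
  have := combination_ge kap0 eps0 e1 e2 Kd e6; rewrite leNgt => /negP; apply.
  exact: low.
- by move=> g /=; rewrite /bad (card_final r S1 S2 g).
Unshelve. all: by end_near. Qed.
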